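(* $\mathsf{D}_0(C_2^5)=11$ and $k_{\mathsf{D}}(C_2^5)=10$. Additionally, $\mathsf{D}_{1}(C_2^5)=6$, $\mathsf{D}_{2}(C_2^5)=10$, $\mathsf{D}_{3}(C_2^5)=13$, $\mathsf{D}_{4}(C_2^5)=16$, $\mathsf{D}_{5}(C_2^5)=19$, $\mathsf{D}_{6}(C_2^5)=21$, $\mathsf{D}_{7}(C_2^5)=23$, $\mathsf{D}_{8}(C_2^5)=26$, and $\mathsf{D}_{9}(C_2^5)=28$.
   Context: $C_2^5$ is the elementary abelian $2$-group of rank $5$. A sequence over a finite abelian group $G$ is a finite unordered list of elements with repetitions; zero-sum means its terms sum to $0$. $\mathsf{D}_k(G)$ ($k\in\mathbb{N}$) is the smallest $\ell$ such that every sequence over $G$ of length at least $\ell$ has $k$ disjoint non-empty zero-sum subsequences. It is known that there exists $\mathsf{D}_0(G)\in\mathbb{N}_0$ with $\mathsf{D}_k(G)=\mathsf{D}_0(G)+k\exp(G)$ for all sufficiently large $k$; $k_{\mathsf{D}}(G)$ is the minimal $k_0\in\mathbb{N}$ with $\mathsf{D}_k(G)=\mathsf{D}_0(G)+k\exp(G)$ for all $k\ge k_0$. *)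

(* Defs.v *)
From mathcomp Require Import all_boot all_order all_algebra.
Set Implicit Arguments. Unset Strict Implicit. Unset Printing Implicit Defensive.
Import GRing.Theory.
Local Open Scope ring_scope.

(* Sequences over a finite abelian group G (a zmodType) are represented by
   [seq G]; the order of terms is irrelevant for all notions below. *)

(* [s] has [k] pairwise disjoint non-empty zero-sum subsequences: there is a
   labelling of the positions of [s] by [option 'I_k] (None = unused) such
   that every label class j is non-empty and its terms sum to 0. *)
Definition has_disjoint_zs (G : zmodType) (k : nat) (s : seq G) : Prop :=
  exists f : 'I_(size s) -> option 'I_k,
    forall j : 'I_k,
      (exists i : 'I_(size s), f i = Some j) /\
      \sum_(i < size s | f i == Some j) s`_i = 0.

Definition is_Dk (G : zmodType) (k l : nat) : Prop :=
  (forall s : seq G, (l <= size s)%N -> has_disjoint_zs k s) /\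
  (forall l' : nat, (forall s : seq G, (l' <= size s)%N -> has_disjoint_zs k s) ->
     (l <= l')%N).

(* Eventual linear behaviour D_k(G) = d + k * e for all k >= k0,
   where e = exp(G). *)
Definition lin_from (G : zmodType) (e d k0 : nat) : Prop :=
  forall k, (k0 <= k)%N -> is_Dk G k (d + k * e).

Definition is_D0 (G : zmodType) (e d : nat) : Prop :=
  exists k0, lin_from G e d k0.

Definition is_kD (G : zmodType) (e d k0 : nat) : Prop :=
  (0 < k0)%N /\ lin_from G e d k0 /\
  (forall k1, (0 < k1)%N -> lin_from G e d k1 -> (k0 <= k1)%N).

Definition C2_5 : zmodType := 'rV['F_2]_5.

(* Main.v *)
(** Deleting a zero term, or two equal terms, from a sequence over $C_2^5$ costs
    one zero-sum block, and $D_{k+1} \ge D_k + 2$; so the upper bounds reduce to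
    sets of non-zero vectors, i.e. sets [A] of points of PG(4,2), of size $D_k$.
    A family of more than 32 subsets of [A] contains two with the same sum, whose
    symmetric difference is a block: all subsets for $k = 1$, the pairs for
    $k = 2$.  If [A] contains a line, removing it leads from $D_k - 3$ points to
    $D_k$ points for $k = 3, 4, 5, 8, 10$, and every set of 17 points contains a
    line.  What remains are the line-free sets of 13 and 16 points and, for
    $k = 9, 7, 6$, the complements of sets of 3, 8 and 10 points.  These are
    classified up to GL(5,2) by adding one point at a time; a certificate names,
    for each representative and each new point, the next representative and a
    linear map, and explicit blocks are given for the final representatives.

    For the lower bounds, weights are chosen such that every block weighs at
    least [c] while the whole sequence weighs at most [c * k + 1]; then [k] blocks
    exhaust the sequence up to one term, which fixes its sum. *)

From Stdlib Require Import BinNat.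
Require Import Defs.
From mathcomp Require Import all_boot all_order all_algebra.
Set Implicit Arguments. Unset Strict Implicit. Unset Printing Implicit Defensive.
Import GRing.Theory.
Local Open Scope ring_scope.

(** * Packings of sequences *)

Section Packings.
Variable G : zmodType.
Implicit Types (s b : seq G) (k : nat).

Definition zs_block b := (b != [::]) && (\sum_(x <- b) x == 0).

(** Equivalent to the labelling of positions in [has_disjoint_zs], but visibly stable under
    reordering and under adding a block, as inductions on [k] require. *)
Definition packs k s :=
  exists bs rest, [/\ size bs = k, all zs_block bs & perm_eq s (flatten bs ++ rest)].

(** Each predicate has the same count on both sides, since its count over [I] splits along the
    fibres of [f]. *)
Lemma perm_fibres (I J : finType) (f : I -> J) :
  perm_eq (enum I) (flatten [seq [seq i <- enum I | f i == j] | j <- enum J]).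
Proof.
apply/permP => a; rewrite count_flatten -map_comp sumnE big_map.
rewrite -sum1_count (partition_big f predT) //= big_enum /=.
by apply: eq_bigr => j _; rewrite sum1_count count_filter.
Qed.

Lemma packs_of_has_disjoint_zs k s : has_disjoint_zs k s -> packs k s.
Proof.
(* The classes labelled [Some j] become the blocks, and the class of [None] becomes the rest. *)
case=> f fP; pose cls o := [seq s`_i | i : 'I_(size s) <- enum 'I_(size s) & f i == o].
exists [seq cls (Some j) | j <- enum 'I_k], (cls None); split.
- by rewrite size_map size_enum_ord.
- apply/allP => _ /mapP[j _ ->]; have [[i fi] sum0] := fP j.
  rewrite /zs_block -size_eq0 size_map size_filter -lt0n -has_count; apply/andP; split.
    by apply/hasP; exists i; rewrite ?mem_enum //= fi.
  by rewrite big_map big_filter big_enum_cond /= sum0.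
- have sE : s = [seq s`_i | i : 'I_(size s) <- enum 'I_(size s)].
    by rewrite (map_comp (nth 0 s) val) val_enum_ord map_nth_iota0 // take_size.
  rewrite {1}sE; apply: perm_trans (perm_map _ (perm_fibres f)) _.
  have -> : enum {: option 'I_k} = None :: [seq Some j | j <- enum 'I_k].
    by rewrite !enumT [in LHS]unlock.
  by rewrite /= map_cat perm_catC map_flatten -!map_comp.
Qed.

(** Each term is tagged with the number of its block, and the terms of [rest] with [None].
    Reordering the tagged list into the order of [s] turns the tags into a labelling of
    positions. *)
Lemma has_disjoint_zs_of_packs k s : packs k s -> has_disjoint_zs k s.
Proof.
case=> bs [rest [szbs /allP bsP ps]].
pose lab := [seq [seq (Some j, x) | x <- nth [::] bs j] | j : 'I_k <- enum 'I_k].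
pose z : seq (option 'I_k * G) := flatten lab ++ [seq (None, x) | x <- rest].
have z2 : map snd z = flatten bs ++ rest.
  rewrite map_cat -map_comp map_id map_flatten -[map _ lab]map_comp; congr (flatten _ ++ _).
  rewrite -[RHS](@mkseq_nth _ [::]) szbs /mkseq -val_enum_ord -map_comp.
  by apply: eq_map => j /=; rewrite -map_comp map_id.
(* [perm_iotaP] lists the positions of [flatten bs ++ rest] in the order of [s]; the same list [Is]
   applied to [z] carries the tags along. *)
have [Is pI sE] : exists2 Is, perm_eq Is (iota 0 (size z)) & s = [seq (nth (None, 0) z i).2 | i <- Is].
  move: ps; rewrite -z2 => /(perm_iotaP 0)[Is]; rewrite size_map => pI sE.
  exists Is => //; rewrite sE; apply/eq_in_map => i; rewrite (perm_mem pI) mem_iota => /= lt_i.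
  by rewrite (nth_map (None, 0)).
pose z' := [seq nth (None, 0) z i | i <- Is].
have pz : perm_eq z' z.
  by apply: perm_trans (perm_map _ pI) _; rewrite map_nth_iota0 // take_size.
have szs : size s = size z' by rewrite sE !size_map.
have snth i : s`_i = (nth (None, 0) z' i).2.
  case: (ltnP i (size z')) => lti; last by rewrite !nth_default // szs.
  by rewrite sE /z' !(nth_map 0%N) // -(size_map (nth (None, 0) z)).
exists (fun i => (nth (None, 0) z' i).1) => j.
have /andP[b0 /eqP sum0] : zs_block (nth [::] bs j).
  by apply: bsP; rewrite mem_nth // szbs.
split.
  case E: (nth [::] bs j) b0 => [//|x b] _.
  have: (Some j, x) \in z'.
    rewrite (perm_mem pz) mem_cat; apply/orP; left; apply/flattenP.
    exists [seq (Some j, y) | y <- nth [::] bs j]; last by rewrite E mem_head.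
    by apply/mapP; exists j; rewrite ?mem_enum.
  by case/(nthP (None, 0)) => i; rewrite -szs => lti e; exists (Ordinal lti); rewrite /= e.
transitivity (\sum_(p <- z' | p.1 == Some j) p.2).
  rewrite (big_nth (None, 0)) -szs big_mkord.
  by apply: eq_bigr => i _; rewrite snth.
(* Back in the order of [z], the terms of [rest] and of the blocks other than [j] carry the wrong
   tag, so only block [j] contributes. *)
rewrite (perm_big _ pz) /= big_cat /= [X in _ + X]big_map [X in _ + X]big_pred0 // addr0.
rewrite big_flatten /= big_map big_enum /= (bigD1 j) //= big_map /=.
rewrite (eq_bigl predT) => [|x]; last by rewrite /= eqxx.
rewrite sum0 add0r big1 // => i ne; rewrite big_map big1 // => x /eqP[/eqP e].
by rewrite e in ne.
Qed.

Lemma packs0 s : packs 0 s.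
Proof. by exists [::], s. Qed.

Lemma packs_perm k s t : perm_eq s t -> packs k t -> packs k s.
Proof.
by move=> p [bs [r [? ? q]]]; exists bs, r; split=> //; apply: perm_trans p q.
Qed.

Lemma packs_block k b s : zs_block b -> packs k s -> packs k.+1 (b ++ s).
Proof.
move=> bP [bs [r [<- bsP p]]]; exists (b :: bs), r; split=> //=.
  exact/andP.
by rewrite -catA perm_cat2l.
Qed.

(* A packing leaves out terms of total weight at most 1, that is nothing or a
   single term of weight 1, and their sum is the sum of [s]. *)
Lemma not_packs (w : G -> nat) (c k : nat) s :
    (forall b r, zs_block b -> perm_eq s (b ++ r) -> (c <= \sum_(x <- b) w x)%N) ->
    (forall x, x \in s -> (0 < w x)%N) ->
    (\sum_(x <- s) w x <= c * k + 1)%N ->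
    \sum_(x <- s) x != 0 ->
    (forall x, x \in s -> w x = 1%N -> x != \sum_(y <- s) y) ->
  ~ packs k s.
Proof.
move=> cP w0 Wk s0 sN [bs [rest [szbs bsP p]]].
have Wf : (c * k <= \sum_(x <- flatten bs) w x)%N.
  (* [c * k] is rewritten as the sum of [c] over the [k] blocks, so that the comparison is made
     block by block. *)
  rewrite big_flatten /= -szbs -[leqLHS]iter_addn_0 -(count_predT bs) -big_const_seq.
  rewrite big_seq_cond [leqRHS]big_seq_cond; apply: leq_sum => b; rewrite andbT => bin.
  have [i /= pi] : exists r, perm_eq (flatten bs) (b ++ r).
    exists (flatten (rem b bs)).
    by rewrite (perm_trans (perm_flatten (perm_to_rem bin))).
  apply: (cP _ (i ++ rest)); first exact: (allP bsP).
  by apply: perm_trans p _; rewrite catA perm_cat2r.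
have Sf : \sum_(x <- flatten bs) x = 0.
  rewrite big_flatten /= big_seq_cond big1 // => b.
  by rewrite andbT => /(allP bsP)/andP[_ /eqP].
move: Wk s0 sN; rewrite !(perm_big _ p) /= !big_cat /= Sf add0r.
move=> Wk; have {Wk Wf} : (\sum_(x <- rest) w x <= 1)%N.
  by rewrite -(leq_add2l (c * k)) (leq_trans _ Wk) // leq_add2r.
have {w0} : {in rest, forall x, (0 < w x)%N}.
  by move=> x xr; apply: w0; rewrite (perm_mem p) mem_cat xr orbT.
have : {subset rest <= s} by move=> x xr; rewrite (perm_mem p) mem_cat xr orbT.
(* An empty rest contradicts the non-zero sum; a single term has weight 1 and equals the sum, which
   is excluded; two terms already weigh at least 2. *)
case: rest {p} => [|x [|y r]] sub w0; first by rewrite !big_nil eqxx.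
  rewrite !big_seq1 => w1 _ /(_ x); rewrite sub ?mem_head // eqxx.
  by have := w0 x (mem_head _ _); case: (w x) w1 => [|[|]] // _ _ /(_ isT erefl).
rewrite !big_cons; have := w0 y; have := w0 x; rewrite !inE !eqxx orbT => /(_ isT) + /(_ isT).
by case: (w x) => // a; case: (w y) => // c'; rewrite !addSn addnS.
Qed.

(** One sequence of length exactly [l] without a packing settles minimality: it refutes every
    candidate bound up to [l]. *)
Lemma is_Dk_intro k l :
  (forall s, (l.+1 <= size s)%N -> packs k s) ->
  (exists2 s, size s = l & ~ packs k s) -> is_Dk G k l.+1.
Proof.
move=> up [s szs ns]; split=> [t /up|l' lP]; first exact: has_disjoint_zs_of_packs.
rewrite ltnNge; apply/negP => le; apply: ns; apply: packs_of_has_disjoint_zs.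
by apply: lP; rewrite szs.
Qed.

End Packings.

(** * Packings of sets of points *)

Local Notation V := 'rV['F_2]_5.

Lemma addxx (x : V) : x + x = 0.
Proof. by apply/rowP => i; rewrite !mxE -mulr2n -mulr_natr pchar_Fp_0 // mulr0. Qed.

Lemma oppv (x : V) : - x = x.
Proof. by apply/eqP; rewrite -subr_eq0 -opprD oppr_eq0 addxx. Qed.

Lemma card_V : #|{: V}| = 32%N.
Proof. by rewrite card_mx card_Fp. Qed.

(** Blocks are removed one after another, which makes them disjoint without further conditions. *)
Fixpoint set_packs k (A : {set V}) : Prop :=
  if k is k'.+1 then
    exists C : {set V},
      [/\ C \subset A, C != set0, \sum_(x in C) x = 0 & set_packs k' (A :\: C)]
  else True.

Lemma set_packsS k (A B : {set V}) : A \subset B -> set_packs k A -> set_packs k B.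
Proof.
elim: k A B => //= k IHk A B AB [C [CA C0 sC /IHk IH]].
by exists C; split=> //; [apply: subset_trans AB | apply: IH; apply: setSD].
Qed.

Lemma packs_of_set_packs k (A : {set V}) : set_packs k A -> packs k (enum A).
Proof.
elim: k A => [|k IHk] A; first by move=> _; apply: packs0.
case=> C [CA C0 sC /IHk IH].
apply: (@packs_perm _ _ _ (enum C ++ enum (A :\: C))).
  rewrite -(setID A C) (setIidPr CA).
  apply: uniq_perm; rewrite ?cat_uniq ?enum_uniq //= ?andbT.
    by apply/hasPn => x; rewrite !mem_enum !inE => /andP[].
  by move=> x; rewrite mem_cat !mem_enum !inE; case: (x \in C).
apply: packs_block => //; rewrite /zs_block big_enum /= sC eqxx andbT.
by rewrite -size_eq0 -cardE cards_eq0.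
Qed.

(** * Zero-sum subsets by the pigeonhole principle *)

Lemma sum_symdiff (X Y : {set V}) :
  \sum_(x in (X :\: Y) :|: (Y :\: X)) x = \sum_(x in X) x + \sum_(x in Y) x.
Proof.
rewrite [X in _ = X + _](big_setID Y) [X in _ = _ + X](big_setID X) /= (setIC Y X).
rewrite addrACA addxx add0r (big_setID Y) /= addrC.
by congr (_ + _); apply: eq_bigl => x; rewrite !inE; case: (x \in X); case: (x \in Y).
Qed.

(** Only 32 sums are available, so two members of [F] collide. The bound [m] on their sizes keeps
    their symmetric difference small, leaving room for a further block. *)
Lemma zs_of_family (F : {set {set V}}) (A : {set V}) (m : nat) :
    (forall X, X \in F -> X \subset A /\ (#|X| <= m)%N) -> (32 < #|F|)%N ->
  exists C : {set V},
    [/\ C \subset A, C != set0, \sum_(x in C) x = 0 & (#|C| <= m + m)%N].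
Proof.
move=> FA ltF; pose S (X : {set V}) := \sum_(x in X) x.
case: (boolP [exists X in F, exists Y in F, (X != Y) && (S X == S Y)]) => [|noX].
  case/exists_inP=> X XF /exists_inP[Y YF /andP[XY /eqP SXY]].
  have [XA cX] := FA X XF; have [YA cY] := FA Y YF.
  exists ((X :\: Y) :|: (Y :\: X)); split.
  - by rewrite subUset !(subset_trans (subsetDl _ _)).
  - apply: contraNneq XY => /setP e; apply/eqP/setP => x.
    by have := e x; rewrite !inE; case: (x \in X); case: (x \in Y).
  - by rewrite sum_symdiff -[\sum_(x in X) x]/(S X) SXY addxx.
  - rewrite (leq_trans (leq_card_setU _ _)) // leq_add //.
      exact: leq_trans (subset_leq_card (subsetDl _ _)) cX.
    exact: leq_trans (subset_leq_card (subsetDl _ _)) cY.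
(* Without a collision the sum is injective on [F], which embeds more than 32 sets into the 32
   vectors. *)
suff /card_in_imset cS : {in F &, injective S}.
  by move: ltF; rewrite -cS ltnNge -card_V max_card.
move=> X Y XF YF SXY; apply: contraNeq noX => XY.
by apply/exists_inP; exists X => //; apply/exists_inP; exists Y; rewrite // XY SXY /=.
Qed.

Lemma set_packs_ge6 (A : {set V}) : (6 <= #|A|)%N -> set_packs 1 A.
Proof.
move=> cA; have [|| C [CA C0 sC _]] := @zs_of_family (powerset A) A #|A|.
- by move=> X; rewrite inE => XA; split=> //; apply: subset_leq_card.
(* There are at least 2 ^ 6 = 64 subsets. *)
- by rewrite card_powerset (@leq_trans (2 ^ 6)) // leq_exp2l.
by exists C.
Qed.

Lemma set_packs_ge10 (A : {set V}) : (10 <= #|A|)%N -> set_packs 2 A.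
Proof.
move=> cA; have [|| C [CA C0 sC cC]] :=
  @zs_of_family [set X : {set V} | X \subset A & #|X| == 2%N] A 2.
- by move=> X; rewrite inE => /andP[XA /eqP ->].
(* Ten points have 45 > 32 pairs. The block found has at most four points, so six remain for the
   next one. *)
- rewrite cards_draws (@leq_trans 'C(10, 2)) // leq_bin2l //.
exists C; split=> //; apply: set_packs_ge6.
by rewrite cardsD (setIidPr CA) (leq_sub cA cC).
Qed.

(** For distinct non-zero [x] and [y], the points [x], [y], [x + y] form a line of PG(4,2). The case
    [x = y] says that a non-empty [A] does not contain 0. *)
Definition line_free (A : {set V}) := [forall x in A, forall y in A, x + y \notin A].

Lemma line_freeS (A B : {set V}) : A \subset B -> line_free B -> line_free A.
Proof.
move=> AB /forall_inP fB; apply/forall_inP => x xA; apply/forall_inP => y yA.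
have /forall_inP := fB x (subsetP AB _ xA).
by move=> /(_ y (subsetP AB _ yA)); apply: contra; apply: (subsetP AB).
Qed.

Lemma ex_line (A : {set V}) : 0 \notin A -> ~~ line_free A ->
  exists C : {set V}, [/\ C \subset A, C != set0, \sum_(x in C) x = 0 & #|C| = 3%N].
Proof.
move=> A0 /forall_inPn[x xA /forall_inPn[y yA]]; rewrite negbK => xyA.
have xy : x != y by apply: contraNneq A0 => e; rewrite e addxx in xyA.
have x0 : x != 0 by apply: contraNneq A0 => <-.
have y0 : y != 0 by apply: contraNneq A0 => <-.
have yn : y \notin [set x + y] by rewrite inE -subr_eq0 opprD addrCA subrr addr0 oppr_eq0.
have xn : x \notin y |: [set x + y].
  by rewrite !inE negb_or xy -subr_eq0 opprD addrA subrr add0r oppr_eq0.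
exists (x |: (y |: [set x + y])); split.
- by apply/subsetP => z; rewrite !inE => /or3P[] /eqP ->.
- by apply/set0Pn; exists x; rewrite !inE eqxx.
- by rewrite big_setU1 // big_setU1 //= big_set1 addrA addxx.
- by rewrite cardsU1 xn cardsU1 yn cards1.
Qed.

(** For [a] in [A], the sets [A] and [a + A] have at least 17 of the 32 vectors each, hence meet; a
    common element [x = a + y] exhibits [a], [y] and [a + y] in [A]. *)
Lemma line_of_ge17 (A : {set V}) : (17 <= #|A|)%N -> ~~ line_free A.
Proof.
move=> cA; have /card_gt0P[a aA] : (0 < #|A|)%N by apply: leq_trans cA.
have injD : injective (+%R a) by apply: addrI.
have : (0 < #|A :&: (+%R a @: A)|)%N.
  rewrite -(ltn_add2l #|A :|: (+%R a @: A)|) addn0 cardsUI card_imset //.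
  by apply: (@leq_trans (17 + 17)); rewrite ?leq_add // ltnS (leq_trans (max_card _)) ?card_V.
case/card_gt0P => x; rewrite inE => /andP[xA /imsetP[y yA e]].
by apply/forall_inPn; exists a => //; apply/forall_inPn; exists y; rewrite // negbK -e.
Qed.

(** A line is a block that uses up only three points. *)
Lemma set_packs_line k n :
    (forall A : {set V}, 0 \notin A -> (n <= #|A|)%N -> set_packs k A) ->
  forall A : {set V}, 0 \notin A -> ~~ line_free A -> (n + 3 <= #|A|)%N -> set_packs k.+1 A.
Proof.
move=> IH A A0 nf cA; have [C [CA C0 sC cC]] := ex_line A0 nf.
exists C; split=> //; apply: IH; first by rewrite inE (negPf A0) andbF.
by rewrite cardsD (setIidPr CA) cC -(addnK 3%N n) leq_sub2r.
Qed.

(** * Points as binary numbers *)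

(* The coordinates of [vec n] are the five low bits of [n], so that bitwise
   exclusive or is addition. *)
Definition vec (n : N) : V := \row_i (N.testbit n (N.of_nat i))%:R.

(** The codes of the non-zero vectors, that is, of the points of PG(4,2). *)
Definition points : seq N := [seq N.of_nat i | i <- iota 1 31].

Definition vset (r : seq N) : {set V} := [set v in [seq vec x | x <- r]].

Lemma vsetP r v : reflect (exists2 x, x \in r & v = vec x) (v \in vset r).
Proof. by rewrite inE; apply: mapP. Qed.

Lemma vset_f r x : x \in r -> vec x \in vset r.
Proof. by move=> xr; apply/vsetP; exists x. Qed.

Lemma vec0 : vec 0 = 0.
Proof. by apply/rowP => i; rewrite !mxE. Qed.

Lemma vecD x y : vec (N.lxor x y) = vec x + vec y.
Proof.
apply/rowP => i; rewrite !mxE N.lxor_spec.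
by case: N.testbit; case: N.testbit; rewrite ?addr0 ?add0r //; apply/val_inj.
Qed.

Lemma vec_foldr (b : seq N) : vec (foldr N.lxor 0%num b) = \sum_(x <- b) vec x.
Proof. by elim: b => [|x b IHb]; rewrite ?big_nil ?vec0 // big_cons /= vecD IHb. Qed.

Lemma vec_point_neq0 x : x \in points -> vec x != 0.
Proof.
move=> xP; apply/eqP => /rowP e.
(* Checked by evaluation: every number from 1 to 31 has one of its five low bits set. *)
have : all (fun x => has (fun i => N.testbit x (N.of_nat i)) (iota 0 5)) points by [].
move=> /allP/(_ x xP)/hasP[i]; rewrite mem_iota /= => lti.
by have := e (Ordinal lti); rewrite !mxE /=; case: N.testbit.
Qed.

Lemma vec_inj : {in points &, injective vec}.
Proof.
move=> x y xP yP e; apply/eqP; apply: contraT => xy.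
have xyP : N.lxor x y \in points.
  (* Checked by evaluation: two distinct codes differ by the code of a point, whose vector is
     non-zero. *)
  have : all (fun x => all (fun y => (x == y) || (N.lxor x y \in points)) points) points by [].
  by move=> /allP/(_ x xP)/allP/(_ y yP); rewrite (negPf xy).
by have := vec_point_neq0 xyP; rewrite vecD e addxx eqxx.
Qed.

Lemma uniq_vec r : uniq r -> {subset r <= points} -> uniq [seq vec x | x <- r].
Proof. by move=> ur rP; rewrite map_inj_in_uniq // => x y /rP xP /rP yP; apply: vec_inj. Qed.

Lemma card_vset r : uniq r -> {subset r <= points} -> #|vset r| = size r.
Proof. by move=> ur rP; rewrite cardsE (card_uniqP (uniq_vec ur rP)) size_map. Qed.

(** The 31 codes give distinct non-zero vectors, and there are only 31 of these. *)
Lemma vset_points : vset points = [set~ 0].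
Proof.
apply/eqP; rewrite eqEcard; apply/andP; split.
  by apply/subsetP => _ /vsetP[x xP ->]; rewrite !inE vec_point_neq0.
by rewrite cardsC1 card_V card_vset.
Qed.

Lemma vec_surj (v : V) : v != 0 -> exists2 x, x \in points & v = vec x.
Proof. by move=> v0; apply/vsetP; rewrite vset_points !inE. Qed.

Lemma mem_vset r x : {subset r <= points} -> x \in points -> (vec x \in vset r) = (x \in r).
Proof.
move=> rP xP; apply/vsetP/idP => [[y yr /vec_inj ->]|xr] //; last by exists x.
exact: rP.
Qed.

(** A decidable form of a packing. [D] marks the permitted codes: the members of a representative
    for line-free sets, the non-members for complements. *)
Definition solution (D : pred N) (bs : seq (seq N)) :=
  [&& all (fun b => (b != [::]) && (foldr N.lxor 0%num b == 0%num)) bs,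
      uniq (flatten bs) & all (fun x => (x \in points) && D x) (flatten bs)].

Lemma set_packs_solution D bs (A : {set V}) :
    solution D bs -> (forall x, x \in points -> D x -> vec x \in A) ->
  set_packs (size bs) A.
Proof.
elim: bs D A => //= b bs IHbs D A /and3P[/= /andP[/andP[b0 /eqP sb] bsP]].
rewrite cat_uniq => /and3P[ub /hasPn nb ubs]; rewrite all_cat => /andP[/allP bD /allP bsD] DA.
have bP : {subset b <= points} by move=> x /bD/andP[].
exists (vset b); split.
- by apply/subsetP => _ /vsetP[x /bD/andP[xP Dx] ->]; apply: DA.
- case: b b0 {sb ub nb bD bP} => // x b _; apply/set0Pn; exists (vec x).
  by rewrite vset_f ?mem_head.
- rewrite (eq_bigl (mem [seq vec x | x <- b])) => [|x]; last by rewrite inE.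
  by rewrite -big_uniq ?uniq_vec //= big_map -vec_foldr sb vec0.
(* The codes of the first block cease to be permitted, matching its removal from [A]. *)
- apply: (IHbs (fun x => D x && (x \notin b))).
    rewrite /solution bsP ubs /=; apply/allP => x xbs.
    by have := bsD x xbs; have := nb x xbs => /= -> /andP[-> ->].
  by move=> x xP /andP[Dx xb]; rewrite inE DA // mem_vset // xb.
Qed.

(** * Orbit representatives *)

(** Entry [i] of [M] is the code of the image of the unit vector [i]; [lin] is the computable
    counterpart of the matrix action [act]. *)
Definition lin (M : seq N) (x : N) : N :=
  foldr (fun i y => if N.testbit x (N.of_nat i) then N.lxor (nth 0%num M i) y else y)
    0%num (iota 0 5).

Definition act (M : seq N) (v : V) : V := v *m \matrix_(i < 5) vec (nth 0%num M i).

Lemma act_vec M x : act M (vec x) = vec (lin M x).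
Proof.
pose F i := (N.testbit x (N.of_nat i))%:R *: vec (nth 0%num M i).
rewrite /act mulmx_sum_row (eq_bigr (fun i : 'I_5 => F i)) => [|i _]; last by rewrite rowK mxE.
rewrite -(big_mkord predT F) /lin /index_iota subn0.
elim: (iota 0 5) => [|i l IHl]; rewrite ?big_nil ?vec0 // big_cons IHl /= /F.
by case: N.testbit; rewrite ?scale1r ?scale0r ?add0r ?vecD.
Qed.

Lemma actD M : {morph act M : x y / x + y}.
Proof. by move=> x y; rewrite /act mulmxDl. Qed.

(** Trivial kernel, tested on all points. The bound 32 is essential because [vec] reads only five
    bits: below it, a non-zero code has a non-zero vector. *)
Definition lin_regular M := all (fun x => [&& lin M x != 0%num & N.ltb (lin M x) 32]) points.

Lemma mem_points x : x != 0%num -> N.ltb x 32 -> x \in points.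
Proof. by case: x => [|p] // _; do 6 (destruct p as [p|p|] => //). Qed.

(** If two distinct vectors had the same image, their difference would be a point sent to 0. *)
Lemma act_inj M : lin_regular M -> injective (act M).
Proof.
move=> /allP Mreg v w e; apply/eqP; rewrite -subr_eq0; apply: contraT.
case/vec_surj=> x xP vwE; have /andP[l0 l32] := Mreg x xP.
have := vec_point_neq0 (mem_points l0 l32).
by rewrite -act_vec -vwE oppv actD e addxx eqxx.
Qed.

(** Over the field with two elements, an injective additive self-map of the space is an element of
    GL(5,2), so [A] lies in the orbit of [vset r]. *)
Definition equivalent (A : {set V}) (r : seq N) :=
  exists f : V -> V, [/\ injective f, {morph f : x y / x + y} & A = f @: vset r].

Lemma morph_add0 (f : V -> V) : {morph f : x y / x + y} -> f 0 = 0.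
Proof. by move=> fD; apply: (addIr (f 0)); rewrite -fD !add0r. Qed.

Lemma set_packs_imset (f : V -> V) k (A : {set V}) :
  injective f -> {morph f : x y / x + y} -> set_packs k A -> set_packs k (f @: A).
Proof.
move=> fI fD; elim: k A => //= k IHk A [C [CA C0 sC /IHk IH]]; exists (f @: C); split.
- exact: imsetS.
- by rewrite -card_gt0 card_imset // card_gt0.
- rewrite big_imset /=; last by move=> x y _ _; apply: fI.
  by rewrite -(big_morph f fD (morph_add0 fD)) sC morph_add0.
- apply: set_packsS IH; apply/subsetP => _ /imsetP[x /setDP[xA xC] ->].
  by rewrite inE !mem_imset // xC.
Qed.

Lemma set_packs_equivalent k A r :
  equivalent A r -> set_packs k (vset r) -> set_packs k A.
Proof. by case=> f [fI fD ->]; apply: set_packs_imset. Qed.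

(** An injective [f] fixing 0 sends points outside [vset r] to points outside [A]. This inclusion
    suffices, as packings persist in larger sets. *)
Lemma set_packs_equivalentC k A r :
  equivalent A r -> set_packs k (~: (0 |: vset r)) -> set_packs k (~: (0 |: A)).
Proof.
case=> f [fI fD ->] /(set_packs_imset fI fD); apply: set_packsS.
apply/subsetP => _ /imsetP[x + ->]; rewrite !in_setC !in_setU1 !negb_or => /andP[x0 xr].
by rewrite mem_imset // xr andbT -(morph_add0 fD) (inj_eq fI).
Qed.

(* The linear map [M] sends [r] onto [t]: an injection between sets of the same
   cardinality. *)
Definition transports (M : seq N) (r t : seq N) :=
  [&& lin_regular M, size t <= size r & all (fun x => lin M x \in t) r]%N.

Lemma vset_transports M r t : uniq r -> {subset r <= points} ->
  transports M r t -> vset t = act M @: vset r.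
Proof.
move=> ur rP /and3P[/act_inj fI st /allP Mt]; apply/esym/eqP; rewrite eqEcard; apply/andP; split.
  by apply/subsetP => _ /imsetP[_ /vsetP[x xr ->] ->]; rewrite act_vec vset_f // Mt.
by rewrite card_imset // (card_vset ur rP) (leq_trans _ st) // cardsE (leq_trans (card_size _)) ?size_map.
Qed.

(** * Classification by adding one point at a time *)

(* The low 25 bits of a certificate are the images of the five unit vectors under
   a linear map; the rest is the index of the target representative. *)
Definition cert_map (m : N) : seq N :=
  [seq N.land (N.shiftr m (N.of_nat (5 * i))) 31 | i <- iota 0 5].

Definition cert_index (m : N) : nat := N.to_nat (N.shiftr m 25).

(** In the second alternative [x] is the third point of a line through two points of [r]. In the
    third, the map goes from the new representative to the extended set [x :: r]. *)
Definition extension_ok (lf : bool) (R' : seq (seq N)) (r : seq N) (x m : N) :=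
  [|| x \in r, lf && has (fun y => N.lxor x y \in r) r |
      transports (cert_map m) (nth [::] R' (cert_index m)) (x :: r)].

Definition well_formed (r : seq N) := uniq r && all (mem points) r.

(** As [zip] truncates to the shorter list, the length conditions ensure that every representative
    and every point has a certificate. *)
Definition step_ok lf (R R' : seq (seq N)) (C : seq (seq N)) :=
  [&& all well_formed R', size R <= size C &
      all (fun p => (size points <= size p.2) &&
             all (fun q => extension_ok lf R' p.1 q.1 q.2) (zip points p.2))
          (zip R C)]%N.

Fixpoint chain_ok lf R (L : seq (seq (seq N) * seq (seq N))) :=
  if L is (C, R') :: L' then step_ok lf R R' C && chain_ok lf R' L' else true.

(** Each orbit must occur at least once; nothing is claimed about the representatives being
    inequivalent. *)
Definition covers (lf : bool) n (R : seq (seq N)) :=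
  all well_formed R /\
  forall A : {set V}, 0 \notin A -> #|A| = n -> (lf -> line_free A) ->
  exists2 r, r \in R & equivalent A r.

Lemma covers0 lf : covers lf 0 [:: [::]].
Proof.
split=> // A _ /cards0_eq -> _; exists [::]; rewrite ?mem_head //.
exists id; split=> //; rewrite imset_id; apply/esym/setP => x.
by rewrite !inE.
Qed.

Lemma ex_mem_zip (S T : eqType) (s : seq S) (t : seq T) x :
  (size s <= size t)%N -> x \in s -> exists y, (x, y) \in zip s t.
Proof.
elim: s t => // a s IHs [|b t] //= st; rewrite inE => /orP[/eqP ->|/IHs h].
  by exists b; rewrite mem_head.
by have [y hy] := h t st; exists y; rewrite inE hy orbT.
Qed.

(** Deleting a point [a] of [A] leaves an image [f @: vset r] of a known representative. Pulling [a]
    back along [f] gives a point [x], and the certificate for [r] and [x] applies to [A]. *)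
Lemma covers_step lf n R R' C : covers lf n R -> step_ok lf R R' C -> covers lf n.+1 R'.
Proof.
move=> [wfR cR] /and3P[wfR' szC /allP stepP]; split=> // A A0 cA lfA.
have /card_gt0P[a aA] : (0 < #|A|)%N by rewrite cA.
have [|||r rR [f [fI fD Af]]] := cR (A :\ a).
- by rewrite inE (negPf A0) andbF.
- by move: cA; rewrite (cardsD1 a) aA => -[].
- by move=> /lfA; apply: line_freeS; apply: subsetDl.
(* An injective self-map of a finite set has an inverse, which takes [a] to the coordinates of
   [r]. *)
have [g fg gf] : bijective f by apply: injF_bij.
have g0 : g a != 0.
  by apply: contraNneq A0 => e; rewrite -(morph_add0 fD) -e gf.
have [x xP gx] := vec_surj g0.
have AE : A = f @: vset (x :: r).
  rewrite -(setD1K aA) Af; apply/setP => v; rewrite in_setU1; apply/orP/imsetP.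
    case=> [/eqP ->|/imsetP[_ /vsetP[y yr ->] ->]].
      by exists (vec x); rewrite ?vset_f ?mem_head // -gx gf.
    by exists (vec y); rewrite // vset_f // inE yr orbT.
  case=> _ /vsetP[y yxr ->] ->; move: yxr; rewrite inE => /orP[/eqP ->|yr].
    by left; rewrite -gx gf.
  by right; rewrite imset_f // vset_f.
have rP : {subset r <= points} by have /andP[_ /allP] := allP wfR r rR.
have [c /stepP/andP[szc /allP extP]] := ex_mem_zip szC rR.
have [m /extP] := ex_mem_zip szc xP => /or3P[xr|/andP[/lfA fA /hasP[y yr xyr]]|tr].
(* If [x] were in [r], then [a] would lie in [A :\ a]. *)
- have : a \notin A :\ a by rewrite !inE eqxx.
  by rewrite Af -(gf a) gx mem_imset // mem_vset // xr.
(* The images under [f] of [x], [y] and their sum would violate line-freeness of [A]. *)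
- have /forall_inP/(_ (f (vec x))) := fA.
  rewrite AE mem_imset // vset_f ?mem_head // => /(_ isT)/forall_inP/(_ (f (vec y))).
  rewrite mem_imset // vset_f ?inE ?yr ?orbT // => /(_ isT).
  by rewrite -fD -vecD mem_imset // vset_f // inE xyr orbT.
- set r' := nth _ _ _ in tr.
  (* An index out of range yields the empty list, which is too short to be mapped onto [x :: r]. *)
  have r'R : r' \in R'.
    apply: contraT => nR; move: tr; rewrite /r' nth_default.
      by case/and3P.
    by rewrite leqNgt; apply: contra nR => lt; rewrite mem_nth.
  have /andP[ur' /allP r'P] := allP wfR' r' r'R.
  exists r' => //; exists (f \o act (cert_map m)); split.
  + by apply: inj_comp fI _; apply: act_inj; case/and3P: tr.
  + by move=> u v /=; rewrite actD fD.
  + by rewrite imset_comp -(vset_transports ur' r'P tr).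
Qed.

Lemma covers_chain lf n R L :
  covers lf n R -> chain_ok lf R L -> covers lf (n + size L) (last R (unzip2 L)).
Proof.
elim: L n R => [|[C R'] L IHL] n R cR /=; first by rewrite addn0.
by case/andP=> /(covers_step cR)/IHL h /h; rewrite addSnnS.
Qed.

(** * Packings from a classification *)

Lemma ex_subset_card (A : {set V}) n :
  (n <= #|A|)%N -> exists2 B : {set V}, B \subset A & #|B| = n.
Proof.
case/card_geqP=> s [us szs sA]; exists [set x in s].
  by apply/subsetP => x; rewrite inE => /sA.
by rewrite cardsE (card_uniqP us).
Qed.

Definition solutions_ok k (D : seq N -> pred N) (R : seq (seq N)) (S : seq (seq (seq N))) :=
  (size R <= size S)%N &&
  all (fun p => (size p.2 == k) && solution (D p.1) p.2) (zip R S).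

Lemma solutions_okP k D R S r : solutions_ok k D R S -> r \in R ->
  exists2 bs, size bs = k & solution (D r) bs.
Proof.
case/andP=> szS /allP SP rR.
by have [bs /SP/andP[/eqP <- sol]] := ex_mem_zip szS rR; exists bs.
Qed.

(** Any [n] points of [A] form a line-free set, in the orbit of some representative, and the
    explicit blocks for it are carried over by the equivalence. *)
Lemma set_packs_covers n k R S (A : {set V}) :
    covers true n R -> solutions_ok k (fun r => mem r) R S ->
  0 \notin A -> (n <= #|A|)%N -> line_free A -> set_packs k A.
Proof.
move=> [wfR cR] SP A0 /ex_subset_card[B BA cB] fA.
have [||r rR Br] := cR B _ cB; first by apply: contra A0; apply: (subsetP BA).
  by move=> _; apply: line_freeS fA.
have [bs <- sol] := solutions_okP SP rR; apply: set_packsS BA _.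
apply: set_packs_equivalent Br _; apply: (set_packs_solution sol) => x xP xr.
exact: vset_f.
Qed.

Lemma set_packs_coversC n k R S (A : {set V}) :
    covers false n R -> solutions_ok k (fun r => [pred x | x \notin r]) R S ->
  0 \notin A -> (31 - n <= #|A|)%N -> (n <= 31)%N -> set_packs k A.
Proof.
move=> [wfR cR] SP A0 /ex_subset_card[A' AA' cA'] n31.
have A'0 : 0 \notin A' by apply: contra A0; apply: (subsetP AA').
apply: set_packsS AA' _.
(* [B] consists of the points missing from [A']. It has exactly [n] elements, so it is [B] that is
   classified. *)
pose B := ~: (0 |: A'); have A'E : A' = ~: (0 |: B).
  by apply/setP => x; rewrite !inE negb_or negbK; case: eqP => [->|] //=; apply/negbTE.
have cB : #|B| = n.
  by rewrite cardsCs setCK card_V cardsU1 A'0 cA' add1n -subSn // subKn // leqW.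
rewrite A'E; have [||//|r rR Br] := cR B; rewrite ?inE ?eqxx //.
have /andP[_ /allP rP] := allP wfR r rR.
have [bs <- sol] := solutions_okP SP rR.
apply: set_packs_equivalentC Br _; apply: (set_packs_solution sol) => x xP xr.
by rewrite in_setC in_setU1 negb_or vec_point_neq0 // mem_vset.
Qed.

(** * Certificates and explicit blocks *)

(* Row [i] of the first component of a step belongs to the [i]-th current
   representative, and its [j]-th entry to the extension by the point [j + 1]; it
   is irrelevant, and set to 0, if that point is already present or completes a
   line of a line-free set.  The second component lists the next representatives. *)
Definition chain_3 : seq (seq (seq N) * seq (seq N)) :=
[::([::[::0x1041041; 0x1041022; 0x1041023; 0x1040824; 0x1040825; 0x1040826; 0x1040827; 0x1020828;
0x1020829; 0x102082a; 0x102082b; 0x102082c; 0x102082d; 0x102082e; 0x102082f; 0x820830; 0x820831;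
0x820832; 0x820833; 0x820834; 0x820835; 0x820836; 0x820837; 0x820838; 0x820839; 0x82083a;
0x82083b; 0x82083c; 0x82083d; 0x82083e; 0x82083f]], [::[::1]]); ([::[::0; 0x1041041; 0x1041061;
0x1040881; 0x10408a1; 0x10408c1; 0x10408e1; 0x1020828; 0x1020921; 0x1020941; 0x1020961; 0x1020981;
0x10209a1; 0x10209c1; 0x10209e1; 0x820830; 0x820a21; 0x820a41; 0x820a61; 0x820a81; 0x820aa1;
0x820ac1; 0x820ae1; 0x820838; 0x820b21; 0x820b41; 0x820b61; 0x820b81; 0x820ba1; 0x820bc1;
0x820be1]], [::[::1; 2]]); ([::[::0; 0; 0x1041041; 0x3041041; 0x3041441; 0x3041841; 0x3041c41;
0x3020828; 0x3022441; 0x3022841; 0x3022c41; 0x3023041; 0x3023441; 0x3023841; 0x3023c41; 0x2820830;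
0x2824441; 0x2824841; 0x2824c41; 0x2825041; 0x2825441; 0x2825841; 0x2825c41; 0x2820838; 0x2826441;
0x2826841; 0x2826c41; 0x2827041; 0x2827441; 0x2827841; 0x2827c41]], [::[::1; 2; 3]; [::1; 2;
4]])]%num.

(** Three points form a line or a triangle. Off the line, eight lines and a block of four exhaust
    the 28 points; off the triangle, nine lines leave only the point 7. *)
Definition solutions_3 : seq (seq (seq N)) :=
[::[::[::14; 20; 26]; [::8; 23; 31]; [::10; 17; 27]; [::4; 25; 29]; [::6; 11; 13]; [::12; 16; 28];
[::7; 18; 21]; [::5; 19; 22]; [::9; 15; 24; 30]]; [::[::3; 21; 22]; [::12; 18; 30]; [::5; 26; 31];
[::15; 19; 28]; [::10; 17; 27]; [::14; 23; 25]; [::9; 20; 29]; [::8; 16; 24]; [::6; 11; 13]]]%num.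

Definition chain_8 : seq (seq (seq N) * seq (seq N)) :=
[::([::[::0; 0; 0; 0x1040824; 0x1040825; 0x1040826; 0x1040827; 0x1020828; 0x1020829; 0x102082a;
0x102082b; 0x102082c; 0x102082d; 0x102082e; 0x102082f; 0x820830; 0x820831; 0x820832; 0x820833;
0x820834; 0x820835; 0x820836; 0x820837; 0x820838; 0x820839; 0x82083a; 0x82083b; 0x82083c;
0x82083d; 0x82083e; 0x82083f]; [::0; 0; 0x1040824; 0; 0x1041022; 0x1041041; 0x3041041; 0x5020828;
0x5049041; 0x5022841; 0x5022c41; 0x5061041; 0x5069041; 0x5071041; 0x5079041; 0x4820830; 0x4889041;
0x4824841; 0x4824c41; 0x48a1041; 0x48a9041; 0x48b1041; 0x48b9041; 0x4820838; 0x48c9041; 0x4826841;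
0x4826c41; 0x48e1041; 0x48e9041; 0x48f1041; 0x48f9041]], [::[::1; 2; 4; 6]; [::1; 2; 4; 7]; [::1;
2; 4; 8]]); ([::[::0; 0; 0x1041061; 0; 0x10408a1; 0; 0x10408e1; 0x3020901; 0x3020921; 0x3020941;
0x3020961; 0x3020981; 0x30209a1; 0x30209c1; 0x30209e1; 0x2820830; 0x2820a21; 0x2820a41; 0x2820a61;
0x2820a81; 0x2820aa1; 0x2820ac1; 0x2820ae1; 0x2820b01; 0x2820b21; 0x2820b41; 0x2820b61; 0x2820b81;
0x2820ba1; 0x2820bc1; 0x2820be1]; [::0; 0; 0x1041041; 0; 0x1040881; 0x10408e1; 0; 0x5020828;
0x5020829; 0x502082a; 0x502082b; 0x502082c; 0x502082d; 0x502082e; 0x502082f; 0x4820830; 0x4820831;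
0x4820832; 0x4820833; 0x4820834; 0x4820835; 0x4820836; 0x4820837; 0x4820838; 0x4820839; 0x482083a;
0x482083b; 0x482083c; 0x482083d; 0x482083e; 0x482083f]; [::0; 0; 0x3010504; 0; 0x3020502;
0x3020901; 0x5020828; 0; 0x3040482; 0x3040881; 0x5040824; 0x3041041; 0x5041022; 0x5041041;
0x7041041; 0x8820830; 0x8824441; 0x8824841; 0x8824c41; 0x88a1041; 0x88a9041; 0x88b1041; 0x88b9041;
0x9841041; 0x9941041; 0x9a41041; 0x9b41041; 0x9c41041; 0x9d41041; 0x9e41041; 0x9f41041]], [::[::1;
2; 3; 4; 7]; [::1; 2; 4; 8; 12]; [::1; 2; 4; 8; 14]; [::1; 2; 4; 8; 15]; [::1; 2; 4; 8; 16]]);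
([::[::0; 0; 0; 0; 0x1041441; 0x1041841; 0; 0x5020828; 0x5020829; 0x502082a; 0x502082b; 0x502082c;
0x502082d; 0x502082e; 0x502082f; 0x4820830; 0x4820831; 0x4820832; 0x4820833; 0x4820834; 0x4820835;
0x4820836; 0x4820837; 0x4820838; 0x4820839; 0x482083a; 0x482083b; 0x482083c; 0x482083d; 0x482083e;
0x482083f]; [::0; 0; 0x3041041; 0; 0x5041422; 0x5041841; 0x9041c41; 0; 0x5022422; 0x5022841;
0x9022c41; 0; 0x5023422; 0x5023841; 0x9023c41; 0xc820830; 0xc824441; 0xc824841; 0xc824c41;
0xc825041; 0xc825441; 0xc825841; 0xc825c41; 0xc826041; 0xc826441; 0xc826841; 0xc826c41; 0xc827041;
0xc827441; 0xc827841; 0xc827c41]; [::0; 0; 0x900b904; 0; 0x900b902; 0x5041041; 0x70408e1; 0;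
0x900b882; 0x5022041; 0x7020961; 0x5023841; 0x70209a1; 0; 0x900a082; 0xe820830; 0xe820a21;
0xe820a41; 0xe820a61; 0xe820a81; 0xe820aa1; 0xe820ac1; 0xe820ae1; 0xe820b01; 0xe820b21; 0xe820b41;
0xe820b61; 0xe820b81; 0xe820ba1; 0xe820bc1; 0xe820be1]; [::0; 0; 0x900bd04; 0; 0x900bd02;
0x9013d01; 0x9041041; 0; 0x900bc82; 0x9013c81; 0x9022041; 0x9023c41; 0x9012081; 0x900a082; 0;
0xb041041; 0xb141041; 0xb241041; 0xb341041; 0xb441041; 0xb541041; 0xb641041; 0xb741041; 0xb841041;
0xb941041; 0xba41041; 0xbb41041; 0xbc41041; 0xbd41041; 0xbe41041; 0xbf41041]; [::0; 0; 0xc20a090;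
0; 0xc40a050; 0xc412030; 0xe410510; 0; 0xc809050; 0xc811030; 0xe810490; 0xc820830; 0xe820450;
0xe820830; 0xb041041; 0; 0xc182082; 0xc282081; 0xe20c104; 0xc482041; 0xe40c102; 0xe414101;
0xa820830; 0xc881041; 0xe80c082; 0xe814081; 0xa440830; 0xe824041; 0xa241030; 0xa141050;
0x10820830]], [::[::1; 2; 3; 4; 5; 6]; [::1; 2; 3; 4; 8; 12]; [::1; 2; 4; 6; 8; 14]; [::1; 2; 4;
7; 8; 11]; [::1; 2; 4; 7; 8; 15]; [::1; 2; 4; 8; 15; 16]; [::1; 2; 4; 8; 16; 24]; [::1; 2; 4; 8;
16; 28]; [::1; 2; 4; 8; 16; 31]]); ([::[::0; 0; 0; 0; 0; 0; 0x1041041; 0x7020828; 0x7020829;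
0x702082a; 0x702082b; 0x702082c; 0x702082d; 0x702082e; 0x702082f; 0x6820830; 0x6820831; 0x6820832;
0x6820833; 0x6820834; 0x6820835; 0x6820836; 0x6820837; 0x6820838; 0x6820839; 0x682083a; 0x682083b;
0x682083c; 0x682083d; 0x682083e; 0x682083f]; [::0; 0; 0; 0; 0x5062062; 0x5062061; 0x5062041; 0;
0x5061062; 0x5061061; 0x5061041; 0; 0x5041062; 0x5041061; 0x5041041; 0x8820830; 0x8820831;
0x8820832; 0x8820833; 0x8820834; 0x8820835; 0x8820836; 0x8820837; 0x8820838; 0x8820839; 0x882083a;
0x882083b; 0x882083c; 0x882083d; 0x882083e; 0x882083f]; [::0; 0; 0x5072061; 0; 0x50720a1; 0;
0x30408e1; 0; 0x5020921; 0x7051041; 0xb020961; 0x7061041; 0xb0209a1; 0; 0x50209e1; 0x12820830;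
0x12820a21; 0x12820a41; 0x12820a61; 0x12820a81; 0x12820aa1; 0x12820ac1; 0x12820ae1; 0x12820b01;
0x12820b21; 0x12820b41; 0x12820b61; 0x12820b81; 0x12820ba1; 0x12820bc1; 0x12820be1]; [::0; 0;
0x3041041; 0; 0xb020568; 0xb038568; 0; 0; 0xb0404e4; 0xb0584e4; 0; 0xb041041; 0xd041041;
0xd059041; 0xb059041; 0x14820830; 0x14820831; 0x14820832; 0x14820833; 0x14820834; 0x14820835;
0x14820836; 0x14820837; 0x14820838; 0x14820839; 0x1482083a; 0x1482083b; 0x1482083c; 0x1482083d;
0x1482083e; 0x1482083f]; [::0; 0; 0x507a041; 0; 0x507a081; 0x507a082; 0; 0; 0xb048482; 0xb050881;
0xb059041; 0xb061041; 0xb068881; 0xb070482; 0; 0x16820830; 0x16820831; 0x16820832; 0x16820833;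
0x16820834; 0x16820835; 0x16820836; 0x16820837; 0x16820838; 0x16820839; 0x1682083a; 0x1682083b;
0x1682083c; 0x1682083d; 0x1682083e; 0x1682083f]; [::0; 0; 0x1617a090; 0; 0x1617a050; 0x1627a030;
0x16820830; 0; 0x16179050; 0x16279030; 0x16440830; 0x16478830; 0x16241030; 0x16141050; 0; 0;
0x1b07a082; 0x1b07a081; 0x18183d04; 0x1b07a041; 0x18183d02; 0x18283d01; 0x18881041; 0x1b079041;
0x18183c82; 0x18283c81; 0x18482041; 0x18483c41; 0x18282081; 0x18182082; 0x1b041041]; [::0; 0;
0x820a204; 0; 0x840a202; 0x8412201; 0xe881041; 0; 0x121c4082; 0x122c4081; 0x17058824; 0x124c4041;
0x17069022; 0x17071041; 0x1b079041; 0; 0x12888482; 0x12890881; 0x16898824; 0x128a1041; 0x168a9022;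
0x168b1041; 0x1a8b9041; 0; 0x12144082; 0x12244081; 0x170d8824; 0x12444041; 0x170e9022; 0x170f1041;
0x1b0f9041]; [::0; 0; 0xe20a090; 0; 0x161e2202; 0x162e2201; 0x1020f110; 0; 0x161e1202; 0x162e1201;
0x1020f090; 0x124e4041; 0x1440f202; 0x14417201; 0x18483c41; 0; 0x161e2082; 0x162e2081; 0x10824c41;
0x12824041; 0x14809202; 0x14811201; 0x18885c41; 0x12444041; 0x1440a202; 0x14412201; 0x18486c41; 0;
0x16141202; 0x16241201; 0x1020a090]; [::0; 0; 0x1a1fa090; 0; 0x1a1fa050; 0x1a2fa030; 0x1020fd10;
0; 0x1a1f9050; 0x1a2f9030; 0x1020fc90; 0x1a4f8830; 0x1040fc50; 0x10417c30; 0x1b041041; 0;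
0x1b0fa082; 0x1b0fa081; 0x10820830; 0x1b0fa041; 0x10811030; 0x10809050; 0x1a820830; 0x1b0f9041;
0x10412030; 0x1040a050; 0x1a440830; 0x1020a090; 0x1a241030; 0x1a141050; 0]], [::[::1; 2; 3; 4; 5;
6; 7]; [::1; 2; 3; 4; 7; 8; 11]; [::1; 2; 3; 4; 8; 12; 15]; [::1; 2; 4; 6; 8; 10; 12]; [::1; 2; 4;
6; 8; 16; 24]; [::1; 2; 4; 7; 8; 11; 12]; [::1; 2; 4; 7; 8; 11; 13]; [::1; 2; 4; 7; 8; 16; 24];
[::1; 2; 4; 7; 8; 16; 31]; [::1; 2; 4; 8; 12; 16; 28]; [::1; 2; 4; 8; 14; 16; 22]; [::1; 2; 4; 8;
14; 16; 30]; [::1; 2; 4; 8; 15; 16; 23]; [::1; 2; 4; 8; 15; 16; 31]]); ([::[::0; 0; 0; 0; 0; 0; 0;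
0x5020828; 0x5020829; 0x502082a; 0x502082b; 0x502082c; 0x502082d; 0x502082e; 0x502082f; 0x4820830;
0x4820831; 0x4820832; 0x4820833; 0x4820834; 0x4820835; 0x4820836; 0x4820837; 0x4820838; 0x4820839;
0x482083a; 0x482083b; 0x482083c; 0x482083d; 0x482083e; 0x482083f]; [::0; 0; 0; 0; 0x1009568;
0x1009968; 0; 0; 0x100a4e4; 0x100a8e4; 0; 0x1023041; 0x702082d; 0x702082e; 0x1023c41; 0x8820830;
0x8820831; 0x8820832; 0x8820833; 0x8820834; 0x8820835; 0x8820836; 0x8820837; 0x8820838; 0x8820839;
0x882083a; 0x882083b; 0x882083c; 0x882083d; 0x882083e; 0x882083f]; [::0; 0; 0; 0; 0xd00bca2;
0xd013cc1; 0x1022041; 0; 0xd00bd22; 0xd013d41; 0x1041041; 0; 0x1008904; 0x1010504; 0; 0xa820830;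
0xa820831; 0xa820832; 0xa820833; 0xa820834; 0xa820835; 0xa820836; 0xa820837; 0xa820838; 0xa820839;
0xa82083a; 0xa82083b; 0xa82083c; 0xa82083d; 0xa82083e; 0xa82083f]; [::0; 0; 0x1023061; 0;
0x10128a1; 0; 0x10120e1; 0; 0x1011921; 0; 0x1011161; 0; 0x10209a1; 0x5041041; 0xf0209e1;
0x1c820830; 0x1c820a21; 0x1c820a41; 0x1c820a61; 0x1c820a81; 0x1c820aa1; 0x1c820ac1; 0x1c820ae1;
0x1c820b01; 0x1c820b21; 0x1c820b41; 0x1c820b61; 0x1c820b81; 0x1c820ba1; 0x1c820bc1; 0x1c820be1];
[::0; 0; 0x2418510; 0; 0x2228510; 0; 0x2238510; 0; 0x21c4082; 0xa626201; 0x1a4c4161; 0xa616201;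
0x1a2c41a1; 0xa416201; 0x1a2c41e1; 0; 0x2888482; 0xb841881; 0x1a831261; 0xb841841; 0x1a830aa1;
0xb841041; 0x1a820ae1; 0; 0x2144082; 0xa622201; 0x1a444361; 0xa612201; 0x1a2443a1; 0xa412201;
0x1a2443e1]; [::0; 0; 0x1023041; 0; 0xd02a041; 0xd032c41; 0; 0; 0xd049041; 0xd051c41; 0; 0;
0x7023422; 0x7023841; 0xf041041; 0x1e820830; 0x1e820831; 0x1e820832; 0x1e820833; 0x1e820834;
0x1e820835; 0x1e820836; 0x1e820837; 0x1e820838; 0x1e820839; 0x1e82083a; 0x1e82083b; 0x1e82083c;
0x1e82083d; 0x1e82083e; 0x1e82083f]; [::0; 0; 0x702082d; 0; 0x701102b; 0x7011c28; 0; 0; 0x7012027;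
0x7012c24; 0; 0x7023422; 0; 0x11041041; 0x7023441; 0x20820830; 0x20820831; 0x20820832; 0x20820833;
0x20820834; 0x20820835; 0x20820836; 0x20820837; 0x20820838; 0x20820839; 0x2082083a; 0x2082083b;
0x2082083c; 0x2082083d; 0x2082083e; 0x2082083f]; [::0; 0; 0x2410510; 0; 0x2220510; 0x2238510; 0;
0; 0x19049c82; 0x19051c81; 0x15022c41; 0x19061c41; 0x15013481; 0x150138e1; 0x19079041; 0;
0x18889c82; 0x18891c81; 0x14824c41; 0x188a1c41; 0x14815481; 0x148158e1; 0x188b9041; 0; 0x190c9c82;
0x190d1c81; 0x15026c41; 0x190e1c41; 0x15017481; 0x150178e1; 0x190f9041]; [::0; 0; 0x18127d10; 0;
0x18117d10; 0x1820fd10; 0; 0; 0x22720bf0; 0x227207f0; 0x284107f0; 0x227107f0; 0x282207f0;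
0x28120bf0; 0x19041041; 0; 0x227fa082; 0x227fa081; 0x290fa041; 0x227fa041; 0x290fa081; 0x290fa082;
0x18881041; 0x190f9041; 0x28120910; 0x28220510; 0x22710510; 0x28410510; 0x22720510; 0x22720910;
0]; [::0; 0; 0x24e4041; 0; 0xa50f202; 0xa617201; 0x19041c41; 0; 0xa90f202; 0xaa17201; 0x19022c41;
0; 0x840f202; 0x8417201; 0x16483c41; 0; 0xa824422; 0xa824841; 0x184e4c41; 0x1cc24041; 0x1fc85422;
0x1fc85841; 0x25c85c41; 0x1cc44041; 0x1fc86422; 0x1fc86841; 0x25c86c41; 0; 0xa827422; 0xa827841;
0x18487c41]; [::0; 0; 0x141412d0; 0; 0x14140ad0; 0x8815a01; 0x128106d0; 0; 0x14113ad0; 0x1e815a01;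
0x282586d0; 0x1ee15a01; 0x282686d0; 0; 0x141122d0; 0; 0x14145882; 0x1e283901; 0x29072261;
0x1e483901; 0x290722a1; 0; 0x14144082; 0x1e881041; 0x29020b21; 0x21a20a01; 0x26e14361; 0x21c20a01;
0x268143a1; 0x1ee81041; 0x29020be1]; [::0; 0; 0x1a1f4104; 0; 0x1a1f4102; 0xa417a01; 0x150120e1; 0;
0x1a1f4082; 0xa817a01; 0x15011161; 0xa827a01; 0x150209a1; 0; 0x16182082; 0; 0x181f2082;
0x1f212081; 0x22241261; 0x1f422041; 0x22440aa1; 0x1ee81041; 0x22820ae1; 0x1eef1041; 0x22820b21;
0x1ee82041; 0x22440b61; 0x1ee82081; 0x222413a1; 0; 0x18182082]; [::0; 0; 0x141412f0; 0;
0x14140af0; 0x142406f0; 0x16881041; 0; 0x22f20af0; 0x22f206f0; 0x228106f0; 0x22f106f0; 0x228206f0;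
0x22820af0; 0; 0; 0x2377a082; 0x2377a081; 0x2307a041; 0x2377a041; 0x2307a081; 0x2307a082; 0;
0x24881041; 0x26f0c082; 0x26f14081; 0x26824041; 0x26f24041; 0x26814081; 0x2680c082; 0x24f81041];
[::0; 0; 0x1a1fc104; 0; 0x1a1fc102; 0x1a2fc101; 0x19041041; 0; 0x1a1fc082; 0x1a2fc081; 0x19022041;
0x1a4fc041; 0x19012081; 0x1900a082; 0; 0; 0x2510a082; 0x25212081; 0x23341041; 0x25422041;
0x23540881; 0x23620901; 0x24f81041; 0x25841041; 0x23920901; 0x23a40881; 0x24f82041; 0x23c41041;
0x24f82081; 0x24f82082; 0]], [::[::1; 2; 3; 4; 8; 11; 12; 15]; [::1; 2; 3; 4; 8; 12; 16; 28];
[::1; 2; 4; 6; 8; 10; 12; 14]; [::1; 2; 4; 6; 8; 11; 13; 14]; [::1; 2; 4; 6; 8; 14; 16; 22]; [::1;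
2; 4; 6; 8; 16; 24; 30]; [::1; 2; 4; 7; 8; 9; 10; 13]; [::1; 2; 4; 7; 8; 11; 12; 15]; [::1; 2; 4;
7; 8; 11; 13; 14]; [::1; 2; 4; 7; 8; 11; 16; 19]; [::1; 2; 4; 7; 8; 11; 16; 23]; [::1; 2; 4; 7; 8;
15; 16; 23]; [::1; 2; 4; 7; 8; 15; 16; 31]; [::1; 2; 4; 8; 12; 15; 16; 31]; [::1; 2; 4; 8; 12; 16;
20; 24]; [::1; 2; 4; 8; 14; 16; 22; 24]; [::1; 2; 4; 8; 14; 16; 22; 26]; [::1; 2; 4; 8; 15; 16;
19; 28]; [::1; 2; 4; 8; 15; 16; 23; 24]; [::1; 2; 4; 8; 15; 16; 23; 27]; [::1; 2; 4; 8; 16; 19;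
28; 31]])]%num.

Definition solutions_8 : seq (seq (seq N)) :=
[::[::[::7; 27; 28]; [::9; 19; 26]; [::10; 20; 30]; [::5; 24; 29]; [::13; 18; 31]; [::6; 16; 22];
[::14; 23; 25]]; [::[::14; 23; 25]; [::13; 19; 30]; [::5; 26; 31]; [::11; 22; 29]; [::7; 18; 21];
[::6; 9; 15]; [::10; 17; 27]]; [::[::7; 26; 29]; [::5; 25; 28]; [::13; 22; 27]; [::9; 17; 24];
[::3; 20; 23]; [::11; 21; 30]; [::15; 16; 31]]; [::[::9; 20; 29]; [::15; 17; 30]; [::12; 16; 28];
[::5; 26; 31]; [::7; 18; 21]; [::10; 19; 25]; [::3; 24; 27]]; [::[::15; 21; 26]; [::3; 20; 23];
[::13; 18; 31]; [::5; 27; 30]; [::10; 19; 25]; [::9; 17; 24]; [::7; 11; 12]]; [::[::12; 19; 31];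
[::15; 21; 26]; [::13; 22; 27]; [::3; 17; 18]; [::7; 9; 14]; [::10; 23; 29]; [::5; 25; 28]];
[::[::14; 23; 25]; [::11; 20; 31]; [::15; 21; 26]; [::3; 17; 18]; [::6; 27; 29]; [::5; 19; 22];
[::12; 16; 28]]; [::[::14; 18; 28]; [::5; 16; 21]; [::13; 19; 30]; [::9; 22; 31]; [::6; 17; 23];
[::3; 10; 20; 29]; [::24; 25; 26; 27]]; [::[::5; 17; 20]; [::10; 21; 31]; [::3; 29; 30]; [::6; 9;
15]; [::12; 23; 27]; [::16; 19; 25; 26]; [::18; 22; 24; 28]]; [::[::14; 21; 27]; [::6; 9; 15];
[::13; 17; 28]; [::10; 20; 30]; [::5; 24; 29]; [::3; 12; 22; 25]; [::18; 23; 26; 31]]; [::[::6;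
26; 28]; [::12; 18; 30]; [::3; 24; 27]; [::5; 17; 20]; [::10; 21; 31]; [::14; 19; 29]; [::15; 22;
25]]; [::[::10; 18; 24]; [::3; 28; 31]; [::14; 19; 29]; [::11; 17; 26]; [::13; 20; 25]; [::5; 6;
21; 22]; [::9; 12; 27; 30]]; [::[::14; 19; 29]; [::6; 10; 12]; [::9; 17; 24]; [::3; 21; 22];
[::11; 23; 28]; [::13; 20; 25]; [::5; 27; 30]]; [::[::5; 17; 20]; [::14; 18; 28]; [::13; 22; 27];
[::7; 26; 29]; [::11; 21; 30]; [::10; 19; 25]; [::6; 9; 23; 24]]; [::[::7; 25; 30]; [::3; 9; 10];
[::6; 17; 23]; [::5; 26; 31]; [::11; 22; 29]; [::14; 21; 27]; [::15; 19; 28]]; [::[::15; 19; 28];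
[::13; 18; 31]; [::11; 17; 26]; [::9; 20; 29]; [::3; 5; 6]; [::12; 23; 27]; [::7; 25; 30]];
[::[::13; 20; 25]; [::6; 19; 21]; [::12; 17; 29]; [::9; 18; 27]; [::7; 24; 31]; [::5; 10; 15];
[::11; 23; 28]]; [::[::3; 20; 23]; [::7; 9; 14]; [::13; 22; 27]; [::6; 25; 31]; [::12; 17; 29];
[::10; 18; 24]; [::11; 21; 30]]; [::[::9; 19; 26]; [::10; 21; 31]; [::5; 17; 20]; [::3; 29; 30];
[::14; 18; 28]; [::13; 22; 27]; [::7; 11; 12]]; [::[::7; 24; 31]; [::14; 18; 28]; [::3; 25; 26];
[::10; 20; 30]; [::12; 17; 29]; [::6; 11; 13]; [::5; 19; 22]]; [::[::9; 20; 29]; [::10; 17; 27];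
[::3; 21; 22]; [::5; 18; 23]; [::6; 24; 30]; [::7; 11; 12]; [::13; 14; 25; 26]]]%num.

Definition chain_10 : seq (seq (seq N) * seq (seq N)) :=
[::([::[::0; 0; 0; 0; 0x130404a2; 0x130408c1; 0x5041041; 0; 0x1062441; 0x107a841; 0; 0; 0x1043441;
0x105b841; 0; 0x16820830; 0x16820831; 0x16820832; 0x16820833; 0x16820834; 0x16820835; 0x16820836;
0x16820837; 0x16820838; 0x16820839; 0x1682083a; 0x1682083b; 0x1682083c; 0x1682083d; 0x1682083e;
0x1682083f]; [::0; 0; 0; 0; 0xe5e4062; 0xe6e4061; 0xe7e4041; 0; 0xe9e4062; 0xeae4061; 0xebe4041;
0; 0xb041062; 0xb041061; 0xb041041; 0; 0xf141062; 0xf241061; 0xf341041; 0x11441041; 0x14820c55;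
0x14820c36; 0x14820837; 0x11841041; 0x14820c59; 0x14820c3a; 0x1482083b; 0; 0xfd41062; 0xfe41061;
0xff41041]; [::0; 0; 0x5041061; 0; 0x50408a1; 0; 0x50408e1; 0; 0x5020921; 0; 0x5020961; 0;
0x50209a1; 0; 0x50209e1; 0x2c820a01; 0x2c820a21; 0x2c820a41; 0x2c820a61; 0x2c820a81; 0x2c820aa1;
0x2c820ac1; 0x2c820ae1; 0x2c820b01; 0x2c820b21; 0x2c820b41; 0x2c820b61; 0x2c820b81; 0x2c820ba1;
0x2c820bc1; 0x2c820be1]; [::0; 0; 0x13040881; 0; 0x13041041; 0; 0x70408e1; 0; 0x130121c1;
0x13012da1; 0; 0x13013561; 0; 0; 0x13013901; 0x2e820830; 0x2e820831; 0x2e820832; 0x2e820833;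
0x2e820834; 0x2e820835; 0x2e820836; 0x2e820837; 0x2e820838; 0x2e820839; 0x2e82083a; 0x2e82083b;
0x2e82083c; 0x2e82083d; 0x2e82083e; 0x2e82083f]; [::0; 0; 0xb072061; 0; 0xb0720a1; 0; 0x90408e1;
0; 0xb020921; 0x16255a01; 0x2a2b4161; 0x16265a01; 0x2a2b41a1; 0; 0xb0209e1; 0; 0xa820a21;
0x16293901; 0x2a272261; 0x162a3901; 0x2a2722a1; 0; 0xa820ae1; 0x168c1041; 0x2a820b21; 0x2e820b41;
0x30820b61; 0x2e820b81; 0x30820ba1; 0x168f1041; 0x2a820be1]; [::0; 0; 0xe482061; 0; 0xe2820a1; 0;
0xa238608; 0; 0xf020921; 0x342f2881; 0x3c281161; 0x344f3041; 0x3c4809a1; 0x16881041; 0x290209e1;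
0; 0xe820a21; 0x342f4881; 0x3c241261; 0x344f5041; 0x3c440aa1; 0x17041041; 0x28820ae1; 0;
0xa8c8482; 0x16224101; 0x28482361; 0x16414101; 0x282823a1; 0; 0xc820be1]; [::0; 0; 0x1022041; 0;
0x1012481; 0x30120c1; 0; 0; 0; 0; 0x1300b4e4; 0x1300a8e2; 0; 0x13022041; 0x13012481; 0x34820830;
0x34820831; 0x34820832; 0x34820833; 0x34820834; 0x34820835; 0x34820836; 0x34820837; 0x34820838;
0x34820839; 0x3482083a; 0x3482083b; 0x3482083c; 0x3482083d; 0x3482083e; 0x3482083f]; [::0; 0;
0x5041041; 0; 0x13041441; 0x13041841; 0; 0; 0x13022441; 0x13022841; 0; 0; 0x13023441; 0x13023841;
0; 0x36820830; 0x36820831; 0x36820832; 0x36820833; 0x36820834; 0x36820835; 0x36820836; 0x36820837;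
0x36820838; 0x36820839; 0x3682083a; 0x3682083b; 0x3682083c; 0x3682083d; 0x3682083e; 0x3682083f];
[::0; 0; 0x7041041; 0; 0x7040881; 0x70408e1; 0; 0; 0x7020901; 0x7020961; 0; 0x70209a1; 0; 0;
0x70209c1; 0x38820830; 0x38820831; 0x38820832; 0x38820833; 0x38820834; 0x38820835; 0x38820836;
0x38820837; 0x38820838; 0x38820839; 0x3882083a; 0x3882083b; 0x3882083c; 0x3882083d; 0x3882083e;
0x3882083f]; [::0; 0; 0x9041041; 0; 0x1a40c168; 0x1a70c168; 0; 0; 0x1a80c0e4; 0x1ab0c0e4; 0;
0x1a824041; 0x2240b670; 0x2240ba70; 0x1ab24041; 0; 0x1b00a0e4; 0x1b30a0e4; 0; 0x1b022041;
0x2240d568; 0x2240d968; 0x1b322041; 0x1b041041; 0x2280e4e4; 0x2280e8e4; 0x1b341041; 0x22827041;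
0x3a82083d; 0x3a82083e; 0x22827c41]; [::0; 0; 0xa8106f0; 0; 0x281bc168; 0x282bc168; 0; 0;
0x1480de04; 0x14b0de04; 0; 0x288bc041; 0x19041041; 0x19059041; 0x28bbc041; 0; 0x1f120968;
0x1f220568; 0x1b322041; 0x1b422041; 0x1f520568; 0x1f620968; 0; 0x1f759041; 0x32810724; 0x32b10744;
0x1f741041; 0x1f041041; 0x32b107a4; 0x328107c4; 0x1f059041]; [::0; 0; 0xb07a041; 0; 0xb07a081;
0xb07a082; 0; 0; 0x289bc082; 0x28abc081; 0x28bbc041; 0x28cbc041; 0x28dbc081; 0x28ebc082; 0; 0;
0x2917a082; 0x2927a081; 0x2937a041; 0x2947a041; 0x2957a081; 0x2967a082; 0; 0x21041041; 0x2680e482;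
0x26816881; 0x26826c41; 0x26827041; 0x26817481; 0x2680f882; 0x21741041]; [::0; 0; 0xe4fc041; 0;
0xe2fc081; 0xe1fc082; 0; 0; 0x281fc082; 0x282fc081; 0x2a4fc041; 0x284fc041; 0x2a2fc081;
0x2a1fc082; 0; 0; 0x3c78a082; 0x3c792081; 0x1e899041; 0x3c7a2041; 0x1e8a8881; 0x1e8b0482;
0x21741041; 0x21841041; 0x1e8c8482; 0x1e8d0881; 0x3c7da041; 0x1e8e1041; 0x3c7ea081; 0x3c7f2082;
0]; [::0; 0; 0xd041041; 0; 0x1450fe02; 0x14617e01; 0x284fc041; 0; 0x1490fe02; 0x14a17e01;
0x288fc041; 0; 0xe1fc104; 0xe2fc104; 0; 0; 0x1510a082; 0x15212081; 0x29041041; 0x3ccfa041;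
0x24465441; 0x24865841; 0x3cc81041; 0x3ccf9041; 0x24866441; 0x24466841; 0x3cc82041; 0x29f41041;
0x15d12081; 0x15e0a082; 0]; [::0; 0; 0x11041041; 0; 0x168c1422; 0x168c1841; 0x21041c41; 0;
0x164a2422; 0x164a2841; 0x21022c41; 0; 0x16483422; 0x16483841; 0x21423c41; 0; 0x16464422;
0x16464841; 0x20824c41; 0; 0x16445422; 0x16445841; 0x20c25c41; 0; 0x16826422; 0x16826841;
0x20c46c41; 0x2d041041; 0x36827422; 0x36827841; 0x40827c41]; [::0; 0; 0x15040c24; 0; 0x15041422;
0x168c1041; 0x1b0408e1; 0; 0x29648482; 0x34a81041; 0x1f020961; 0x34cb1041; 0x1f6209a1; 0;
0x29078482; 0; 0x28e88482; 0x35241041; 0x1e820a61; 0x35471041; 0x1ee20aa1; 0; 0x288b8482; 0;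
0x2a8c8482; 0x2e8d0881; 0x26811361; 0x2e8e1041; 0x26820ba1; 0x37041041; 0x3e820be1]; [::0; 0;
0x181d3904; 0; 0x181d3902; 0x2e820b41; 0x228168e1; 0; 0x181b3882; 0x2e440ac1; 0x22415961;
0x2e470a01; 0x224141a1; 0; 0x18182082; 0; 0x18175882; 0x2e4809c1; 0x22413a61; 0x2e4b0901;
0x224122a1; 0; 0x18144082; 0x2e8d0881; 0x22811321; 0; 0x18124102; 0x39041041; 0x42820ba1;
0x2e8d1041; 0x22820be1]; [::0; 0; 0x29c10504; 0; 0x2412c102; 0x24234101; 0x1e881041; 0;
0x2414c082; 0x24254081; 0x1e482041; 0x29341041; 0x1e280504; 0x1e180904; 0; 0; 0x3d078504;
0x3d078904; 0; 0x3d079041; 0x33580502; 0x33680901; 0x26482041; 0x3d07a041; 0x33980482; 0x33a80881;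
0x26881041; 0; 0x26180904; 0x26280504; 0x3f041041]; [::0; 0; 0x15040824; 0; 0x15041022;
0x15041041; 0x21041041; 0; 0x3c9b8482; 0x3cab8881; 0x3cb81041; 0x3ccb9041; 0x3cd80881; 0x3ce80482;
0; 0; 0x3d178482; 0x3d278881; 0x3d341041; 0x3d479041; 0x3d540881; 0x3d640482; 0; 0; 0x308c8482;
0x308d0881; 0x268d9041; 0x308e1041; 0x268e8881; 0x268f0482; 0x41041041]; [::0; 0; 0x181dbd04; 0;
0x3377a362; 0x3377a361; 0x26826c41; 0; 0x33b792e2; 0x33b792e1; 0x26445c41; 0x2647c041; 0x33b41201;
0x33b41202; 0; 0; 0x33bb91e2; 0x33bb91e1; 0x26483c41; 0x264ba041; 0x33b81101; 0x33b81102; 0;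
0x268d9041; 0x33782081; 0x33782082; 0; 0x43041041; 0x3a827441; 0x3a827822; 0x308d9041]; [::0; 0;
0x2b010504; 0; 0x33c9c102; 0x33c9c101; 0x23022041; 0; 0x33c9c082; 0x33c9c081; 0x23041041;
0x2b041041; 0x23008904; 0x23010504; 0x3f041041; 0; 0x1e1ff104; 0x1e2ff104; 0; 0x1e4fcc41;
0x1d5e4041; 0x1d6fcc41; 0x1e4e4041; 0x1e8fcc41; 0x1d9e4041; 0x1dafcc41; 0x1e8e4041; 0; 0x1e19c104;
0x1e29c104; 0]], [::[::1; 2; 3; 4; 5; 6; 8; 11; 13]; [::1; 2; 3; 4; 5; 8; 10; 12; 15]; [::1; 2; 3;
4; 7; 8; 11; 12; 15]; [::1; 2; 3; 4; 7; 8; 11; 13; 14]; [::1; 2; 3; 4; 7; 8; 11; 16; 19]; [::1; 2;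
3; 4; 8; 12; 15; 16; 28]; [::1; 2; 3; 4; 8; 12; 15; 16; 31]; [::1; 2; 3; 4; 8; 12; 16; 19; 31];
[::1; 2; 3; 4; 8; 12; 16; 20; 24]; [::1; 2; 4; 5; 6; 8; 11; 13; 14]; [::1; 2; 4; 6; 8; 15; 16; 23;
24]; [::1; 2; 4; 6; 8; 16; 22; 24; 30]; [::1; 2; 4; 7; 8; 11; 13; 16; 23]; [::1; 2; 4; 7; 8; 11;
16; 19; 24]; [::1; 2; 4; 7; 8; 11; 16; 21; 25]; [::1; 2; 4; 7; 8; 11; 16; 23; 28]; [::1; 2; 4; 7;
8; 15; 16; 23; 24]; [::1; 2; 4; 8; 11; 16; 19; 28; 31]; [::1; 2; 4; 8; 11; 16; 21; 24; 30]; [::1;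
2; 4; 8; 11; 16; 23; 27; 28]; [::1; 2; 4; 8; 12; 15; 16; 19; 31]; [::1; 2; 4; 8; 12; 16; 19; 28;
31]; [::1; 2; 4; 8; 12; 16; 20; 24; 28]; [::1; 2; 4; 8; 12; 16; 22; 26; 28]; [::1; 2; 4; 8; 12;
16; 23; 27; 28]; [::1; 2; 4; 8; 13; 16; 22; 27; 28]; [::1; 2; 4; 8; 14; 16; 18; 20; 26]; [::1; 2;
4; 8; 14; 16; 22; 24; 30]; [::1; 2; 4; 8; 14; 16; 22; 26; 28]; [::1; 2; 4; 8; 14; 16; 22; 27; 29];
[::1; 2; 4; 8; 15; 16; 19; 20; 27]; [::1; 2; 4; 8; 15; 16; 19; 28; 31]; [::1; 2; 4; 8; 15; 16; 23;
24; 31]; [::1; 2; 4; 8; 15; 16; 23; 27; 28]]); ([::[::0; 0; 0; 0; 0; 0; 0x300b568; 0; 0x1049041;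
0x2d00b544; 0; 0x2d01b162; 0; 0x3041041; 0x2d01bd01; 0x18820830; 0x18820831; 0x18820832;
0x18820833; 0x18820834; 0x18820835; 0x18820836; 0x18820837; 0x18820838; 0x18820839; 0x1882083a;
0x1882083b; 0x1882083c; 0x1882083d; 0x1882083e; 0x1882083f]; [::0; 0; 0; 0; 0; 0x2d013d01;
0x2d013141; 0; 0x2d00bc82; 0; 0x2d00b0a2; 0; 0x2d00a883; 0x2d00a0a3; 0; 0x1a820830; 0x1a820831;
0x1a820832; 0x1a820833; 0x1a820834; 0x1a820835; 0x1a820836; 0x1a820837; 0x1a820838; 0x1a820839;
0x1a82083a; 0x1a82083b; 0x1a82083c; 0x1a82083d; 0x1a82083e; 0x1a82083f]; [::0; 0; 0; 0; 0x3041441;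
0x3041841; 0; 0; 0x3022441; 0x3022841; 0; 0; 0x3023441; 0x3023841; 0; 0x20820830; 0x20820831;
0x20820832; 0x20820833; 0x20820834; 0x20820835; 0x20820836; 0x20820837; 0x20820838; 0x20820839;
0x2082083a; 0x2082083b; 0x2082083c; 0x2082083d; 0x2082083e; 0x2082083f]; [::0; 0; 0; 0; 0x5041041;
0x5041c41; 0; 0; 0x5022041; 0x5022c41; 0; 0x5023441; 0; 0; 0x5023841; 0x24820830; 0x24820831;
0x24820832; 0x24820833; 0x24820834; 0x24820835; 0x24820836; 0x24820837; 0x24820838; 0x24820839;
0x2482083a; 0x2482083b; 0x2482083c; 0x2482083d; 0x2482083e; 0x2482083f]; [::0; 0; 0; 0; 0x812c168;
0x8134168; 0; 0; 0x814c0e4; 0x81540e4; 0; 0x8464041; 0x2240ce0d; 0x2240ce0e; 0x847c041; 0;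
0x818a0e4; 0x81920e4; 0; 0x84a2041; 0x2240ad15; 0x2240ad16; 0x84ba041; 0x88c1041; 0x22809c99;
0x22809c9a; 0x88d9041; 0x2282083c; 0x2682083d; 0x2682083e; 0x2282083f]; [::0; 0; 0; 0; 0x16f28b90;
0x16f30790; 0xc7e4041; 0; 0x16f48b90; 0x16f50790; 0xcbe4041; 0; 0x8114104; 0x820c104; 0; 0;
0x16f88904; 0x16f90504; 0xd341041; 0xa4a3c41; 0x1e820455; 0x1e820836; 0x28820837; 0xa4c3c41;
0x1e820459; 0x1e82083a; 0x2882083b; 0; 0x16fe8904; 0x16ff0504; 0xdf41041]; [::0; 0; 0; 0;
0x14128bf0; 0x142307f0; 0xc4fc041; 0; 0x14148bf0; 0x142507f0; 0xc8fc041; 0; 0xc1fc104; 0xc2fc104;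
0; 0; 0x14188904; 0x14290504; 0xd041041; 0x144a2041; 0x1c820835; 0x1c440836; 0x148b9041;
0x148c1041; 0x1c440839; 0x1c82083a; 0x144da041; 0xdf41041; 0x142e8504; 0x141f0904; 0]; [::0; 0; 0;
0; 0x601440a2; 0x602440c1; 0x167fa041; 0; 0x60124122; 0x60224141; 0x16bf9041; 0; 0x16d80904;
0x16e80504; 0xd041041; 0; 0xa20fd04; 0xa117d04; 0; 0x14445041; 0x56412035; 0x5640a056; 0xa444041;
0x14826041; 0x56811039; 0x5680905a; 0xa824041; 0xf041041; 0x1430c104; 0x14314104; 0]; [::0; 0; 0;
0; 0xa8c1462; 0xa8c1861; 0xa8c1c41; 0; 0xa4a2462; 0xa4a2861; 0xa4a2c41; 0; 0xa483462; 0xa483861;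
0xa483c41; 0; 0xa464462; 0xa464861; 0xa464c41; 0; 0xa445462; 0xa445861; 0xa445c41; 0; 0xa826462;
0xa826861; 0xa826c41; 0x11041041; 0x2a820c5d; 0x2a820c3e; 0x2a82083f]; [::0; 0; 0x3041041; 0; 0;
0; 0x5041c81; 0; 0x2d023841; 0x2d023441; 0; 0x2d022c41; 0; 0; 0x2d022041; 0x54820830; 0x54820831;
0x54820832; 0x54820833; 0x54820834; 0x54820835; 0x54820836; 0x54820837; 0x54820838; 0x54820839;
0x5482083a; 0x5482083b; 0x5482083c; 0x5482083d; 0x5482083e; 0x5482083f]; [::0; 0; 0x7041861; 0;
0x70418a1; 0; 0xa8c0482; 0; 0x14880482; 0x56f35c81; 0x56834041; 0x56f35c41; 0x56834081;
0x14fb8482; 0; 0; 0x15040482; 0x57733c81; 0x57032041; 0x57733c41; 0x57032081; 0x15778482; 0; 0;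
0x128c8482; 0x1f041881; 0x48830b61; 0x1f041841; 0x488313a1; 0x29041041; 0x2b041041]; [::0; 0;
0xb041061; 0; 0xb0408a1; 0; 0x90408e1; 0; 0xf020921; 0x55012881; 0x59011161; 0x55023041;
0x590209a1; 0x21041041; 0x5d0209e1; 0; 0xc820a21; 0x19891041; 0x2e820a61; 0x19ea1041; 0x2e820aa1;
0; 0xc820ae1; 0; 0xc820b21; 0x190d1041; 0x2e820b61; 0x196e1041; 0x2e820ba1; 0; 0xc820be1]; [::0;
0; 0x2820de0d; 0; 0x2840de0b; 0x28415e08; 0; 0; 0x122406f0; 0x28b0de04; 0; 0x28d0de02; 0;
0x31041041; 0x28d15e01; 0; 0x3316ac48; 0x3326a02b; 0x3335a02d; 0x3345a02d; 0x3356a02b; 0x3366ac48;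
0; 0x33759041; 0x4a412039; 0x33040824; 0x33741022; 0x33041022; 0x33740824; 0x4a41203e;
0x33059041]; [::0; 0; 0x88c1041; 0; 0x7040881; 0x70408e1; 0; 0; 0x3a9804e4; 0x3aa984e4; 0;
0x3ac81041; 0x3303902d; 0x3333902e; 0x3af99041; 0; 0x3b1404e4; 0x3b2584e4; 0; 0x3b441041;
0x32839035; 0x32b39036; 0x3b759041; 0; 0x4e8c88e4; 0x4e8d04e4; 0x35041041; 0x4e8e1c41; 0x4c81103d;
0x4c811c3e; 0x4e8f9041]; [::0; 0; 0x5a20e6b0; 0; 0x5a40e568; 0x42bac119; 0; 0; 0x5a80d4e4;
0x427cc095; 0; 0x5a824041; 0x40159e02; 0x40241201; 0x422cd430; 0; 0x5b00ace2; 0x5b012081;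
0x401a9d04; 0x427ca04b; 0; 0x40480901; 0x424cac28; 0x42ba9047; 0; 0x40880881; 0x428a9c24;
0x41041041; 0x43059c22; 0x43041041; 0x45041041]; [::0; 0; 0x164e4041; 0; 0x56b27028; 0x56b27048;
0; 0; 0x56744024; 0x56744044; 0; 0x2f741041; 0x33041022; 0x33041041; 0x624e4041; 0; 0x5fc89102;
0x5fc91101; 0x4e4e2041; 0x3b041041; 0x5b512081; 0x5b60a082; 0; 0x3d841041; 0x43941041; 0x43a41022;
0x47041041; 0; 0x5f0ea082; 0x5f0f2081; 0x4e881041]; [::0; 0; 0xa8c1041; 0; 0xa8c0881; 0xa8c0482;
0; 0; 0x2f748482; 0x2f750881; 0x2f059041; 0x2f761041; 0x2f068881; 0x2f070482; 0; 0; 0x2ef88482;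
0x2ef90881; 0x2e899041; 0x2efa1041; 0x2e8a8881; 0x2e8b0482; 0; 0; 0x5880e482; 0x58816881;
0x468d9041; 0x58827041; 0x468e8881; 0x468f0482; 0x51041041]; [::0; 0; 0x23040824; 0; 0x4bc82d02;
0x4bc82d01; 0x37041041; 0; 0x321ff204; 0x322ff204; 0; 0x4f022c41; 0x41068901; 0x41070961;
0x4f022041; 0; 0x321ff104; 0x322ff104; 0; 0x4e824c41; 0x408a8a01; 0x408b0a61; 0x4e824041;
0x4e827c41; 0x408c8b81; 0x408d0be1; 0x4e827041; 0; 0x3219c104; 0x3229c104; 0]; [::0; 0;
0x1d880824; 0; 0x1d841022; 0x1d041041; 0x3f041041; 0; 0x575c7a04; 0x570f62a4; 0; 0x484aac41;
0x5fe81041; 0x5f8a9041; 0x48482041; 0; 0x56bc7902; 0x4825d481; 0x5fe40881; 0x568f6162; 0;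
0x5f858881; 0x48244081; 0; 0x4815f882; 0x56b85501; 0x5f540482; 0x568ac161; 0x5f058482; 0;
0x48146082]; [::0; 0; 0x29b80824; 0; 0x49028502; 0x49030901; 0x47041041; 0; 0x1fb82024;
0x1fb82044; 0; 0x59041041; 0x4d06a022; 0x4d072041; 0x53022041; 0; 0x5fc0a082; 0x5fc12081;
0x630e1041; 0x637d9041; 0x5fb12081; 0x5fb0a082; 0; 0x63bb9041; 0x5f712081; 0x5f70a082; 0; 0;
0x5f00a082; 0x5f012081; 0x63c81041]; [::0; 0; 0xd041041; 0; 0x56f0c0a2; 0x56f140c1; 0x3a899041; 0;
0x56f0c122; 0x56f14141; 0x3a49a041; 0; 0x16180904; 0x16280504; 0; 0; 0x15108904; 0x15210504; 0;
0x62fa2041; 0x5e878aa1; 0x5e8786c2; 0x2e483c41; 0x62fc1041; 0x5e478b21; 0x5e478742; 0x2e883c41;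
0x5d041041; 0x29d12081; 0x29e0a082; 0]; [::0; 0; 0xf041041; 0; 0x1fc804a2; 0x1fc808c1; 0x4f041c41;
0; 0x1fc80522; 0x1fc80941; 0x4f022c41; 0; 0x2300a082; 0x23012081; 0x5d041041; 0; 0x17c10504;
0x17f10504; 0; 0x2f4fcc41; 0x5bc85441; 0x5bf9d841; 0x2f7e4041; 0x2f8fcc41; 0x5bc86441; 0x5bf9e841;
0x2fbe4041; 0; 0x17010504; 0x17310504; 0]; [::0; 0; 0x11041041; 0; 0x21041422; 0x21041841;
0x51041c41; 0; 0x21022422; 0x21022841; 0x51022c41; 0; 0x21023422; 0x21023841; 0x51023c41; 0;
0x20824422; 0x20824841; 0x50824c41; 0; 0x20825422; 0x20825841; 0x50825c41; 0; 0x20826422;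
0x20826841; 0x50826c41; 0; 0x20827422; 0x20827841; 0x50827c41]; [::0; 0; 0x13041061; 0;
0x29c81422; 0x55022041; 0x4f0408e1; 0; 0x29c82422; 0x55041041; 0x4f020961; 0; 0x23023422;
0x25023841; 0x530209e1; 0; 0x28824422; 0x54487041; 0x4e4e0a61; 0x544b6841; 0x4e4d0aa1; 0;
0x28825c22; 0x544d5841; 0x4e4b0b21; 0; 0x28826c22; 0; 0x28827422; 0x544e4041; 0x4e480be1]; [::0;
0; 0x13041041; 0; 0x1fc81422; 0x1fc81841; 0x59022041; 0; 0x1fc82422; 0x1fc82841; 0x59041041; 0;
0x27023422; 0x27023841; 0x53023c41; 0; 0x1e824422; 0x1e824841; 0x58487041; 0x584bec41; 0x1e825441;
0x1e825822; 0; 0x584ddc41; 0x1e826441; 0x1e826822; 0; 0; 0x1e827422; 0x1e827841; 0x584e4041];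
[::0; 0; 0x3e20c104; 0; 0x5e1df202; 0x5e2df101; 0x43040824; 0; 0x5e1dc382; 0x5e2dc081; 0x43c20828;
0x1e825b62; 0; 0x4b023841; 0x4c282081; 0; 0x5e1da082; 0x5e2da381; 0x424e0830; 0x1f023761;
0x4a825422; 0; 0x4c144082; 0x4846ec41; 0x336e2081; 0x32de4082; 0; 0; 0x5e1d9102; 0x5e2d9201;
0x4288083c]; [::0; 0; 0x15471061; 0; 0x152408a1; 0x18881041; 0x3b0408e1; 0; 0x15020921;
0x18492041; 0x3b220961; 0x1a483041; 0x3d0209a1; 0; 0x150111e1; 0; 0x16272221; 0; 0x16271261; 0;
0x16440aa1; 0x542d3901; 0x624722e1; 0x542a3881; 0x62871321; 0; 0x16820b61; 0x54881041; 0x62e20ba1;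
0x54492041; 0x62e40be1]; [::0; 0; 0x2b040c24; 0; 0x2b041422; 0x21041041; 0x350408e1; 0;
0x5d048482; 0x55051041; 0x47020961; 0x55061041; 0x470209a1; 0; 0x5d078482; 0; 0x5c888482;
0x54891041; 0x46820a61; 0x548a1041; 0x46820aa1; 0; 0x5c8b8482; 0; 0x5c8c8482; 0x548d1041;
0x46820b61; 0x548e1041; 0x46820ba1; 0; 0x5c8f8482]; [::0; 0; 0x30183904; 0; 0x30183902;
0x25041041; 0x370408e1; 0; 0x30183882; 0x25022041; 0x37020961; 0x25023841; 0x370209a1; 0;
0x30182082; 0; 0x30145882; 0x24824041; 0x36820a61; 0x24825841; 0x36820aa1; 0; 0x30144082;
0x24826841; 0x36820b21; 0; 0x30147082; 0; 0x30146882; 0x24827041; 0x36820be1]; [::0; 0;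
0x4bb83904; 0; 0x4bd83902; 0x27041041; 0x390408e1; 0; 0x4bb8104e; 0x4c2b6e01; 0x4d022041;
0x4c2b7601; 0x4d023841; 0; 0x4bd81048; 0; 0x4bb41056; 0x4c276d01; 0x4c824041; 0x4c277501;
0x4c825841; 0; 0x4bd41050; 0x4c826c41; 0x4c274101; 0x4b04105d; 0; 0x4b64105b; 0; 0x4c827441;
0x4c275901]; [::0; 0; 0x15479041; 0; 0x5732a022; 0x57332041; 0x2e881041; 0; 0x57049022;
0x57051041; 0x2e49a041; 0x3c483041; 0x1c483441; 0x1c483822; 0; 0; 0x61141041; 0x61222041; 0; 0;
0x1f50cd02; 0x1f614d01; 0x6307a041; 0x63379041; 0x1f914081; 0x1fa0c082; 0; 0x58881041; 0x5e447441;
0x5e827841; 0x5849a041]; [::0; 0; 0x5d010504; 0; 0x49009502; 0x49011901; 0x4f041041; 0;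
0x4900a482; 0x49012881; 0x4f022041; 0x5d041041; 0x4f010504; 0x4f008904; 0; 0; 0x63c10504;
0x63f10504; 0; 0x63341041; 0x42241035; 0x42241036; 0x63041041; 0x63f41041; 0x42241039; 0x4224103a;
0x63c41041; 0; 0x63010504; 0x63310504; 0]; [::0; 0; 0x2b040824; 0; 0x2b041022; 0x2b041041;
0x51041041; 0; 0x59048482; 0x59050881; 0x59059041; 0x59061041; 0x59068881; 0x59070482; 0; 0;
0x58888482; 0x58890881; 0x58899041; 0x588a1041; 0x588a8881; 0x588b0482; 0; 0; 0x588c8482;
0x588d0881; 0x588d9041; 0x588e1041; 0x588e8881; 0x588f0482; 0]; [::0; 0; 0x30183d04; 0;
0x4bc83d02; 0x4bc83d01; 0x53041041; 0; 0x4bc83c82; 0x4bc83c81; 0x53022041; 0x53023c41; 0x4bb82081;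
0x4bb82082; 0; 0; 0x4bc45c82; 0x4bc45c81; 0x52824041; 0x52825c41; 0x4bb44081; 0x4bb44082; 0;
0x52826c41; 0x4b747081; 0x4b747082; 0; 0; 0x4b046c82; 0x4b046c81; 0x52827041]], [::[::1; 2; 3; 4;
5; 6; 8; 9; 10; 12]; [::1; 2; 3; 4; 5; 6; 8; 11; 13; 14]; [::1; 2; 3; 4; 5; 7; 8; 11; 13; 14];
[::1; 2; 3; 4; 7; 8; 13; 16; 21; 24]; [::1; 2; 3; 4; 7; 8; 16; 19; 24; 27]; [::1; 2; 3; 4; 7; 8;
16; 23; 24; 31]; [::1; 2; 3; 4; 8; 12; 15; 16; 19; 31]; [::1; 2; 3; 4; 8; 12; 16; 19; 28; 31];
[::1; 2; 3; 4; 8; 12; 16; 20; 24; 28]; [::1; 2; 3; 4; 8; 12; 16; 23; 27; 28]; [::1; 2; 3; 4; 8;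
15; 16; 20; 23; 24]; [::1; 2; 3; 4; 8; 16; 19; 23; 28; 31]; [::1; 2; 4; 6; 8; 10; 12; 16; 22; 26];
[::1; 2; 4; 6; 8; 10; 16; 20; 24; 30]; [::1; 2; 4; 6; 8; 11; 16; 21; 24; 30]; [::1; 2; 4; 6; 8;
13; 16; 21; 24; 30]; [::1; 2; 4; 6; 8; 14; 16; 22; 24; 30]; [::1; 2; 4; 6; 8; 14; 16; 22; 25; 31];
[::1; 2; 4; 6; 8; 14; 16; 22; 26; 28]; [::1; 2; 4; 6; 8; 14; 16; 22; 27; 29]; [::1; 2; 4; 6; 8;
15; 16; 23; 24; 30]; [::1; 2; 4; 6; 8; 15; 16; 23; 24; 31]; [::1; 2; 4; 7; 8; 9; 10; 13; 14; 15];
[::1; 2; 4; 7; 8; 11; 12; 16; 23; 27]; [::1; 2; 4; 7; 8; 11; 13; 14; 16; 23]; [::1; 2; 4; 7; 8;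
11; 14; 16; 23; 28]; [::1; 2; 4; 7; 8; 11; 16; 19; 24; 27]; [::1; 2; 4; 7; 8; 11; 16; 19; 28; 31];
[::1; 2; 4; 7; 8; 11; 16; 19; 29; 30]; [::1; 2; 4; 7; 8; 11; 16; 20; 23; 28]; [::1; 2; 4; 7; 8;
11; 16; 20; 24; 31]; [::1; 2; 4; 7; 8; 11; 16; 21; 24; 30]; [::1; 2; 4; 7; 8; 11; 16; 21; 25; 28];
[::1; 2; 4; 7; 8; 11; 16; 21; 25; 30]; [::1; 2; 4; 7; 8; 11; 16; 21; 25; 31]; [::1; 2; 4; 7; 8;
11; 16; 23; 27; 28]; [::1; 2; 4; 7; 8; 12; 16; 23; 25; 30]; [::1; 2; 4; 7; 8; 14; 16; 22; 26; 29];
[::1; 2; 4; 7; 8; 14; 16; 23; 26; 29]; [::1; 2; 4; 7; 8; 15; 16; 19; 28; 31]; [::1; 2; 4; 7; 8;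
15; 16; 23; 24; 31]; [::1; 2; 4; 7; 8; 15; 16; 23; 27; 28]; [::1; 2; 4; 8; 10; 12; 16; 22; 26;
28]; [::1; 2; 4; 8; 10; 13; 16; 19; 20; 25]; [::1; 2; 4; 8; 11; 12; 16; 23; 27; 28]; [::1; 2; 4;
8; 11; 13; 16; 19; 21; 24]; [::1; 2; 4; 8; 12; 15; 16; 19; 28; 31]; [::1; 2; 4; 8; 13; 16; 22; 27;
29; 30]; [::1; 2; 4; 8; 15; 16; 17; 18; 21; 26]; [::1; 2; 4; 8; 15; 16; 19; 23; 28; 31]])]%num.

Definition solutions_10 : seq (seq (seq N)) :=
[::[::[::13; 20; 25]; [::14; 19; 29]; [::7; 17; 22]; [::16; 21; 27; 30]; [::11; 15; 24; 28];
[::18; 23; 26; 31]]; [::[::7; 17; 22]; [::9; 20; 29]; [::12; 23; 27]; [::15; 16; 31]; [::10; 19;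
25]; [::24; 26; 28; 30]]; [::[::15; 19; 28]; [::12; 18; 30]; [::10; 23; 29]; [::6; 16; 22]; [::9;
17; 24]; [::20; 21; 26; 27]]; [::[::9; 19; 26]; [::10; 22; 28]; [::6; 18; 20]; [::14; 23; 25];
[::12; 17; 29]; [::5; 27; 30]]; [::[::13; 23; 26]; [::6; 9; 15]; [::10; 20; 30]; [::14; 17; 31];
[::11; 18; 25]; [::5; 12; 21; 28]]; [::[::14; 20; 26]; [::15; 22; 25]; [::12; 18; 30]; [::6; 11;
13]; [::10; 17; 27]; [::9; 21; 28]]; [::[::10; 18; 24]; [::6; 27; 29]; [::5; 17; 20]; [::13; 23;
26]; [::9; 21; 28]; [::7; 25; 30]]; [::[::9; 17; 24]; [::7; 10; 13]; [::14; 20; 26]; [::15; 22;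
25]; [::6; 27; 29]; [::11; 21; 30]]; [::[::6; 9; 15]; [::11; 17; 26]; [::10; 19; 25]; [::18; 22;
27; 31]; [::5; 7; 21; 23]; [::13; 14; 29; 30]]; [::[::5; 10; 15]; [::14; 20; 26]; [::6; 19; 21];
[::7; 25; 30]; [::9; 17; 24]; [::13; 18; 31]]; [::[::7; 17; 22]; [::5; 11; 14]; [::9; 18; 27];
[::13; 19; 30]; [::6; 25; 31]; [::10; 12; 26; 28]]; [::[::11; 18; 25]; [::6; 10; 12]; [::7; 9;
14]; [::15; 17; 30]; [::5; 24; 29]; [::13; 22; 27]]; [::[::14; 18; 28]; [::5; 24; 29]; [::15; 17;
30]; [::11; 20; 31]; [::3; 13; 23; 25]; [::7; 9; 21; 27]]; [::[::15; 19; 28]; [::12; 23; 27];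
[::7; 18; 21]; [::3; 25; 26]; [::11; 22; 29]; [::14; 17; 31]]; [::[::7; 19; 20]; [::15; 18; 29];
[::3; 25; 26]; [::10; 17; 27]; [::9; 22; 31]; [::5; 14; 23; 28]]; [::[::10; 17; 27]; [::11; 23;
28]; [::12; 19; 31]; [::15; 18; 29]; [::3; 25; 26]; [::7; 9; 14]]; [::[::15; 19; 28]; [::3; 17;
18]; [::7; 10; 13]; [::5; 26; 31]; [::9; 20; 29]; [::12; 21; 25]]; [::[::12; 20; 24]; [::15; 18;
29]; [::13; 19; 30]; [::7; 27; 28]; [::11; 17; 26]; [::3; 9; 10]]; [::[::3; 9; 10]; [::11; 20;
31]; [::12; 21; 25]; [::5; 27; 30]; [::18; 23; 24; 29]; [::13; 15; 17; 19]]; [::[::5; 9; 12];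
[::10; 19; 25]; [::15; 17; 30]; [::13; 23; 26]; [::7; 18; 21]; [::11; 20; 31]]; [::[::13; 22; 27];
[::9; 19; 26]; [::5; 25; 28]; [::7; 11; 12]; [::14; 17; 31]; [::3; 10; 20; 29]]; [::[::13; 22;
27]; [::11; 21; 30]; [::7; 26; 29]; [::14; 18; 28]; [::5; 9; 12]; [::10; 19; 25]]; [::[::3; 28;
31]; [::12; 23; 27]; [::5; 16; 21]; [::11; 22; 29]; [::6; 18; 20]; [::17; 19; 24; 26]]; [::[::5;
10; 15]; [::3; 25; 26]; [::13; 17; 28]; [::14; 19; 29]; [::6; 24; 30]; [::9; 22; 31]]; [::[::12;
17; 29]; [::6; 18; 20]; [::3; 9; 10]; [::15; 22; 25]; [::5; 26; 31]; [::19; 21; 24; 30]]; [::[::5;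
19; 22]; [::10; 21; 31]; [::15; 20; 27]; [::6; 24; 30]; [::3; 17; 18]; [::9; 13; 25; 29]];
[::[::14; 17; 31]; [::3; 12; 15]; [::9; 20; 29]; [::5; 18; 23]; [::10; 22; 28]; [::6; 13; 21;
30]]; [::[::12; 17; 29]; [::10; 18; 24]; [::14; 20; 26]; [::13; 22; 27]; [::3; 5; 6]; [::9; 23;
30]]; [::[::3; 24; 27]; [::13; 17; 28]; [::14; 23; 25]; [::6; 10; 12]; [::5; 26; 31]; [::9; 15;
18; 20]]; [::[::15; 17; 30]; [::5; 24; 29]; [::6; 25; 31]; [::3; 21; 22]; [::9; 10; 13; 14];
[::18; 19; 26; 27]]; [::[::9; 21; 28]; [::13; 23; 26]; [::3; 29; 30]; [::10; 15; 19; 22]; [::12;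
14; 25; 27]; [::5; 6; 17; 18]]; [::[::3; 28; 31]; [::12; 23; 27]; [::9; 19; 26]; [::5; 14; 22;
29]; [::10; 15; 17; 20]; [::6; 13; 18; 25]]; [::[::6; 10; 12]; [::5; 27; 30]; [::15; 18; 29];
[::9; 17; 24]; [::3; 20; 23]; [::19; 22; 26; 31]]; [::[::6; 27; 29]; [::14; 20; 26]; [::3; 17;
18]; [::10; 22; 28]; [::15; 23; 24]; [::12; 19; 31]]; [::[::14; 18; 28]; [::3; 9; 10]; [::5; 27;
30]; [::6; 15; 20; 29]; [::12; 13; 22; 23]; [::17; 19; 24; 26]]; [::[::6; 9; 15]; [::5; 19; 22];
[::12; 17; 29]; [::13; 21; 24]; [::3; 25; 26]; [::10; 20; 30]]; [::[::6; 19; 21]; [::15; 20; 27];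
[::13; 18; 31]; [::11; 22; 29]; [::9; 17; 24]; [::3; 5; 26; 28]]; [::[::10; 18; 24]; [::6; 19;
21]; [::9; 23; 30]; [::5; 17; 20]; [::3; 28; 31]; [::13; 15; 25; 27]]; [::[::5; 9; 12]; [::6; 18;
20]; [::3; 28; 31]; [::13; 19; 30]; [::10; 17; 27]; [::15; 22; 25]]; [::[::9; 20; 29]; [::12; 21;
25]; [::3; 17; 18]; [::6; 24; 30]; [::13; 23; 26]; [::5; 11; 14]]; [::[::12; 17; 29]; [::14; 20;
26]; [::6; 19; 21]; [::11; 18; 25]; [::10; 22; 28]; [::5; 27; 30]]; [::[::12; 17; 29]; [::3; 13;
14]; [::6; 24; 30]; [::11; 20; 31]; [::5; 19; 22]; [::9; 10; 25; 26]]; [::[::3; 17; 18]; [::7; 24;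
31]; [::14; 19; 29]; [::11; 21; 30]; [::13; 20; 25]; [::6; 9; 15]]; [::[::6; 17; 23]; [::3; 28;
31]; [::11; 22; 29]; [::5; 9; 12]; [::15; 21; 26]; [::7; 14; 18; 27]]; [::[::6; 9; 15]; [::7; 10;
13]; [::3; 17; 18]; [::5; 19; 22]; [::14; 20; 26]; [::24; 25; 30; 31]]; [::[::7; 9; 14]; [::5; 26;
31]; [::6; 10; 12]; [::15; 18; 29]; [::3; 20; 23]; [::25; 27; 28; 30]]; [::[::3; 20; 23]; [::7;
25; 30]; [::10; 17; 27]; [::6; 11; 13]; [::14; 22; 24]; [::18; 21; 26; 29]]; [::[::9; 21; 28];
[::12; 19; 31]; [::10; 18; 24]; [::11; 17; 26]; [::3; 5; 6]; [::14; 23; 25]]; [::[::11; 19; 24];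
[::12; 23; 27]; [::6; 25; 31]; [::7; 9; 14]; [::10; 22; 28]; [::3; 29; 30]]; [::[::10; 17; 27];
[::5; 11; 14]; [::12; 21; 25]; [::6; 18; 20]; [::3; 29; 30]; [::7; 9; 22; 24]]]%num.

(** At size 13 a single representative is left. All its vectors have odd weight, so it avoids the
    hyperplane of even-weight vectors. *)
Definition cap_chain_13 : seq (seq (seq N) * seq (seq N)) :=
[::([::[::0x1041041; 0x1041022; 0x1041023; 0x1040824; 0x1040825; 0x1040826; 0x1040827; 0x1020828;
0x1020829; 0x102082a; 0x102082b; 0x102082c; 0x102082d; 0x102082e; 0x102082f; 0x820830; 0x820831;
0x820832; 0x820833; 0x820834; 0x820835; 0x820836; 0x820837; 0x820838; 0x820839; 0x82083a;
0x82083b; 0x82083c; 0x82083d; 0x82083e; 0x82083f]], [::[::1]]); ([::[::0; 0x1041041; 0x1041061;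
0x1040881; 0x10408a1; 0x10408c1; 0x10408e1; 0x1020828; 0x1020921; 0x1020941; 0x1020961; 0x1020981;
0x10209a1; 0x10209c1; 0x10209e1; 0x820830; 0x820a21; 0x820a41; 0x820a61; 0x820a81; 0x820aa1;
0x820ac1; 0x820ae1; 0x820838; 0x820b21; 0x820b41; 0x820b61; 0x820b81; 0x820ba1; 0x820bc1;
0x820be1]], [::[::1; 2]]); ([::[::0; 0; 0; 0x1041041; 0x1041441; 0x1041841; 0x1041c41; 0x1020828;
0x1022441; 0x1022841; 0x1022c41; 0x1023041; 0x1023441; 0x1023841; 0x1023c41; 0x820830; 0x824441;
0x824841; 0x824c41; 0x825041; 0x825441; 0x825841; 0x825c41; 0x820838; 0x826441; 0x826841;
0x826c41; 0x827041; 0x827441; 0x827841; 0x827c41]], [::[::1; 2; 4]]); ([::[::0; 0; 0; 0; 0; 0;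
0x1041041; 0x3020828; 0x3049041; 0x3022841; 0x3022c41; 0x3061041; 0x3069041; 0x3071041; 0x3079041;
0x2820830; 0x2889041; 0x2824841; 0x2824c41; 0x28a1041; 0x28a9041; 0x28b1041; 0x28b9041; 0x2820838;
0x28c9041; 0x2826841; 0x2826c41; 0x28e1041; 0x28e9041; 0x28f1041; 0x28f9041]], [::[::1; 2; 4; 7];
[::1; 2; 4; 8]]); ([::[::0; 0; 0; 0; 0; 0; 0; 0x1020828; 0x1020829; 0x102082a; 0x102082b;
0x102082c; 0x102082d; 0x102082e; 0x102082f; 0x820830; 0x820831; 0x820832; 0x820833; 0x820834;
0x820835; 0x820836; 0x820837; 0x820838; 0x820839; 0x82083a; 0x82083b; 0x82083c; 0x82083d;
0x82083e; 0x82083f]; [::0; 0; 0; 0; 0; 0; 0x1020828; 0; 0; 0; 0x1040824; 0; 0x1041022; 0x1041041;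
0x3041041; 0x4820830; 0x4824441; 0x4824841; 0x4824c41; 0x48a1041; 0x48a9041; 0x48b1041; 0x48b9041;
0x5841041; 0x5941041; 0x5a41041; 0x5b41041; 0x5c41041; 0x5d41041; 0x5e41041; 0x5f41041]], [::[::1;
2; 4; 8; 14]; [::1; 2; 4; 8; 15]; [::1; 2; 4; 8; 16]]); ([::[::0; 0; 0; 0; 0; 0; 0x10408e1; 0; 0;
0; 0x1020961; 0; 0x10209a1; 0; 0; 0x4820830; 0x4820a21; 0x4820a41; 0x4820a61; 0x4820a81;
0x4820aa1; 0x4820ac1; 0x4820ae1; 0x4820b01; 0x4820b21; 0x4820b41; 0x4820b61; 0x4820b81; 0x4820ba1;
0x4820bc1; 0x4820be1]; [::0; 0; 0; 0; 0; 0; 0; 0; 0; 0; 0; 0; 0; 0; 0; 0x3041041; 0x3141041;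
0x3241041; 0x3341041; 0x3441041; 0x3541041; 0x3641041; 0x3741041; 0x3841041; 0x3941041; 0x3a41041;
0x3b41041; 0x3c41041; 0x3d41041; 0x3e41041; 0x3f41041]; [::0; 0; 0; 0; 0; 0; 0x4410510; 0; 0; 0;
0x4810490; 0; 0x4820450; 0x4820830; 0x3041041; 0; 0; 0; 0x420c104; 0; 0x440c102; 0x4414101;
0x2820830; 0; 0x480c082; 0x4814081; 0x2440830; 0x4824041; 0x2241030; 0x2141050; 0x6820830]],
[::[::1; 2; 4; 7; 8; 11]; [::1; 2; 4; 8; 15; 16]; [::1; 2; 4; 8; 16; 28]; [::1; 2; 4; 8; 16;
31]]); ([::[::0; 0; 0; 0; 0; 0; 0; 0; 0; 0; 0; 0; 0x1041041; 0x1059041; 0; 0x4820830; 0x4820831;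
0x4820832; 0x4820833; 0x4820834; 0x4820835; 0x4820836; 0x4820837; 0x4820838; 0x4820839; 0x482083a;
0x482083b; 0x482083c; 0x482083d; 0x482083e; 0x482083f]; [::0; 0; 0; 0; 0; 0; 0; 0; 0; 0; 0; 0; 0;
0; 0; 0; 0; 0; 0x6183d04; 0; 0x6183d02; 0x6283d01; 0x6881041; 0; 0x6183c82; 0x6283c81; 0x6482041;
0x6483c41; 0x6282081; 0x6182082; 0]; [::0; 0; 0; 0; 0; 0; 0x220f110; 0; 0; 0; 0x220f090; 0;
0x440f202; 0x4417201; 0x6483c41; 0; 0; 0; 0x2824c41; 0; 0x4809202; 0x4811201; 0x6885c41; 0;
0x440a202; 0x4412201; 0x6486c41; 0; 0; 0; 0x220a090]; [::0; 0; 0; 0; 0; 0; 0x220fd10; 0; 0; 0;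
0x220fc90; 0; 0x240fc50; 0x2417c30; 0; 0; 0; 0; 0x2820830; 0; 0x2811030; 0x2809050; 0; 0;
0x2412030; 0x240a050; 0; 0x220a090; 0; 0; 0]], [::[::1; 2; 4; 7; 8; 11; 13]; [::1; 2; 4; 7; 8; 16;
31]; [::1; 2; 4; 8; 14; 16; 22]; [::1; 2; 4; 8; 15; 16; 23]]); ([::[::0; 0; 0; 0; 0; 0; 0; 0; 0;
0; 0; 0; 0; 0x1041041; 0; 0x4820830; 0x4820831; 0x4820832; 0x4820833; 0x4820834; 0x4820835;
0x4820836; 0x4820837; 0x4820838; 0x4820839; 0x482083a; 0x482083b; 0x482083c; 0x482083d; 0x482083e;
0x482083f]; [::0; 0; 0; 0; 0; 0; 0; 0; 0; 0; 0x84107f0; 0; 0x82207f0; 0x8120bf0; 0; 0; 0; 0;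
0x90fa041; 0; 0x90fa081; 0x90fa082; 0; 0; 0x8120910; 0x8220510; 0; 0x8410510; 0; 0; 0]; [::0; 0;
0; 0; 0; 0; 0x28106d0; 0; 0; 0; 0x82586d0; 0; 0x82686d0; 0; 0; 0; 0; 0; 0x9072261; 0; 0x90722a1;
0; 0; 0; 0x9020b21; 0x5a20a01; 0x6e14361; 0x5c20a01; 0x68143a1; 0; 0x9020be1]; [::0; 0; 0; 0; 0;
0; 0; 0; 0; 0; 0; 0; 0; 0; 0; 0; 0; 0; 0; 0; 0; 0; 0; 0; 0x6f0c082; 0x6f14081; 0x6824041;
0x6f24041; 0x6814081; 0x680c082; 0]], [::[::1; 2; 4; 7; 8; 11; 13; 14]; [::1; 2; 4; 7; 8; 11; 16;
19]; [::1; 2; 4; 8; 14; 16; 22; 26]; [::1; 2; 4; 8; 15; 16; 23; 27]; [::1; 2; 4; 8; 16; 19; 28;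
31]]); ([::[::0; 0; 0; 0; 0; 0; 0; 0; 0; 0; 0; 0; 0; 0; 0; 0x4820830; 0x4820831; 0x4820832;
0x4820833; 0x4820834; 0x4820835; 0x4820836; 0x4820837; 0x4820838; 0x4820839; 0x482083a; 0x482083b;
0x482083c; 0x482083d; 0x482083e; 0x482083f]; [::0; 0; 0; 0; 0; 0; 0; 0; 0; 0; 0; 0; 0x240b670;
0x240ba70; 0; 0; 0; 0; 0; 0; 0x240d568; 0x240d968; 0; 0; 0x280e4e4; 0x280e8e4; 0; 0x2827041;
0x682083d; 0x682083e; 0x2827c41]; [::0; 0; 0; 0; 0; 0; 0x28168e1; 0; 0; 0; 0x2415961; 0;
0x24141a1; 0; 0; 0; 0; 0; 0x2413a61; 0; 0x24122a1; 0; 0; 0; 0x2811321; 0; 0; 0x5041041; 0x8820ba1;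
0; 0x2820be1]; [::0; 0; 0; 0; 0; 0; 0; 0; 0; 0; 0; 0; 0; 0; 0; 0; 0; 0; 0; 0; 0; 0; 0; 0; 0; 0; 0;
0x9041041; 0x6827441; 0x6827822; 0]; [::0; 0; 0; 0; 0; 0; 0x3022041; 0; 0; 0; 0x3041041; 0;
0x3008904; 0x3010504; 0; 0; 0; 0; 0; 0; 0x15e4041; 0x16fcc41; 0; 0; 0x19e4041; 0x1afcc41; 0; 0; 0;
0; 0]], [::[::1; 2; 4; 7; 8; 11; 16; 21; 25]; [::1; 2; 4; 8; 11; 16; 19; 28; 31]; [::1; 2; 4; 8;
14; 16; 22; 26; 28]; [::1; 2; 4; 8; 14; 16; 22; 27; 29]; [::1; 2; 4; 8; 15; 16; 23; 27; 28]]);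
([::[::0; 0; 0; 0; 0; 0; 0; 0; 0; 0; 0; 0; 0x4159e02; 0x4241201; 0; 0; 0; 0; 0x41a9d04; 0; 0;
0x4480901; 0; 0; 0; 0x4880881; 0; 0x5041041; 0; 0; 0x7041041]; [::0; 0; 0; 0; 0; 0; 0x1041041; 0;
0; 0; 0; 0; 0x5068901; 0x5070961; 0; 0; 0; 0; 0; 0; 0x48a8a01; 0x48b0a61; 0; 0; 0x48c8b81;
0x48d0be1; 0; 0; 0; 0; 0]; [::0; 0; 0; 0; 0; 0; 0x10408e1; 0; 0; 0; 0x1020961; 0; 0x10209a1; 0; 0;
0; 0; 0; 0x820a61; 0; 0x820aa1; 0; 0; 0; 0x820b21; 0; 0; 0; 0; 0; 0x820be1]; [::0; 0; 0; 0; 0; 0;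
0x30408e1; 0; 0; 0; 0; 0; 0; 0; 0; 0; 0; 0; 0; 0; 0; 0; 0; 0; 0; 0; 0; 0; 0; 0; 0]; [::0; 0; 0; 0;
0; 0; 0; 0; 0; 0; 0; 0; 0; 0; 0; 0; 0; 0; 0; 0; 0; 0; 0; 0; 0; 0; 0; 0; 0; 0; 0]], [::[::1; 2; 4;
7; 8; 11; 16; 19; 28; 31]; [::1; 2; 4; 7; 8; 11; 16; 19; 29; 30]; [::1; 2; 4; 7; 8; 11; 16; 21;
25; 28]; [::1; 2; 4; 7; 8; 11; 16; 21; 25; 31]]); ([::[::0; 0; 0; 0; 0; 0; 0; 0; 0; 0; 0; 0;
0x3023441; 0x3023841; 0; 0; 0; 0; 0; 0; 0x2825441; 0x2825841; 0; 0; 0x2826441; 0x2826841; 0; 0; 0;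
0; 0]; [::0; 0; 0; 0; 0; 0; 0; 0; 0; 0; 0; 0; 0; 0; 0; 0; 0; 0; 0; 0; 0; 0; 0; 0; 0; 0; 0; 0; 0;
0; 0]; [::0; 0; 0; 0; 0; 0; 0; 0; 0; 0; 0; 0; 0x300ace2; 0x3012081; 0; 0; 0; 0; 0xb3cc41; 0; 0;
0xb3d841; 0; 0; 0; 0xb3e841; 0; 0; 0; 0; 0xb3fc41]; [::0; 0; 0; 0; 0; 0; 0; 0; 0; 0; 0; 0;
0x1012081; 0x1512c81; 0; 0; 0; 0; 0x824041; 0; 0; 0xb25441; 0; 0; 0; 0x83e441; 0; 0xb3fc41; 0; 0;
0]], [::[::1; 2; 4; 7; 8; 11; 13; 16; 19; 21; 31]; [::1; 2; 4; 8; 11; 13; 14; 16; 19; 21; 22]]);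
([::[::0; 0; 0; 0; 0; 0; 0; 0; 0; 0; 0; 0; 0; 0x21fd670; 0; 0; 0; 0; 0; 0; 0; 0x21fb568; 0; 0;
0x2182082; 0x229ac81; 0; 0x24ab441; 0; 0; 0]; [::0; 0; 0; 0; 0; 0; 0x1041041; 0; 0; 0; 0; 0; 0; 0;
0; 0; 0; 0; 0; 0; 0; 0; 0; 0; 0x28c9041; 0x28d1041; 0; 0x28e1041; 0; 0; 0x28f9041]], [::[::1; 2;
4; 7; 8; 11; 13; 14; 16; 19; 21; 22]; [::1; 2; 4; 8; 16; 19; 21; 22; 25; 26; 28; 31]]); ([::[::0;
0; 0; 0; 0; 0; 0; 0; 0; 0; 0; 0; 0; 0; 0; 0; 0; 0; 0; 0; 0; 0; 0; 0; 0x159a039; 0x158203a; 0;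
0x138203c; 0; 0; 0x138203f]; [::0; 0; 0; 0; 0; 0; 0x1cd4028; 0; 0; 0; 0x1cb4024; 0; 0x1ab4022;
0x19ac041; 0; 0; 0; 0; 0; 0; 0; 0; 0; 0; 0; 0; 0; 0; 0; 0; 0]], [::[::1; 2; 4; 7; 8; 11; 13; 16;
19; 21; 26; 28; 31]])]%num.

(** Blocks of odd-weight vectors have an even number of terms, hence at least four points; three of
    them take 12 of the 13 points. *)
Definition cap_solutions_13 : seq (seq (seq N)) :=
[::[::[::4; 8; 16; 28]; [::2; 13; 21; 26]; [::7; 11; 19; 31]]]%num.

Definition cap_chain_16 : seq (seq (seq N) * seq (seq N)) :=
[::([::[::0; 0; 0; 0; 0; 0; 0; 0; 0; 0; 0; 0; 0; 0x10209c1; 0; 0; 0; 0; 0; 0; 0; 0x820ac1; 0; 0;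
0x820b21; 0; 0; 0; 0; 0; 0]], [::[::1; 2; 4; 7; 8; 11; 13; 14; 16; 19; 21; 22; 25; 26]]);
([::[::0; 0; 0; 0; 0; 0; 0; 0; 0; 0; 0; 0; 0; 0; 0; 0; 0; 0; 0; 0; 0; 0; 0; 0; 0; 0; 0; 0x1041041;
0; 0; 0x1341041]], [::[::1; 2; 4; 7; 8; 11; 13; 14; 16; 19; 21; 22; 25; 26; 28]]); ([::[::0; 0; 0;
0; 0; 0; 0; 0; 0; 0; 0; 0; 0; 0; 0; 0; 0; 0; 0; 0; 0; 0; 0; 0; 0; 0; 0; 0; 0; 0; 0x1041041]],
[::[::1; 2; 4; 7; 8; 11; 13; 14; 16; 19; 21; 22; 25; 26; 28; 31]])]%num.

(** The representative consists of all 16 vectors of odd weight, here partitioned into four blocks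
    of four. *)
Definition cap_solutions_16 : seq (seq (seq N)) :=
[::[::[::11; 14; 25; 28]; [::7; 13; 16; 26]; [::2; 4; 19; 21]; [::1; 8; 22; 31]]]%num.

(** * Verification of the classifications *)

Definition reps_3 := last [:: [::]] (unzip2 chain_3).
Definition reps_8 := last reps_3 (unzip2 chain_8).
Definition reps_10 := last reps_8 (unzip2 chain_10).
Definition cap_reps_13 := last [:: [::]] (unzip2 cap_chain_13).
Definition cap_reps_16 := last cap_reps_13 (unzip2 cap_chain_16).

Lemma covers_3 : covers false 3 reps_3.
Proof.
have ok : chain_ok false [:: [::]] chain_3 by vm_compute.
exact: (covers_chain (covers0 false) ok).
Qed.

Lemma covers_8 : covers false 8 reps_8.
Proof.
have ok : chain_ok false reps_3 chain_8 by vm_compute.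
exact: (covers_chain covers_3 ok).
Qed.

Lemma covers_10 : covers false 10 reps_10.
Proof.
have ok : chain_ok false reps_8 chain_10 by vm_compute.
exact: (covers_chain covers_8 ok).
Qed.

Lemma covers_cap_13 : covers true 13 cap_reps_13.
Proof.
have ok : chain_ok true [:: [::]] cap_chain_13 by vm_compute.
exact: (covers_chain (covers0 true) ok).
Qed.

Lemma covers_cap_16 : covers true 16 cap_reps_16.
Proof.
have ok : chain_ok true cap_reps_13 cap_chain_16 by vm_compute.
exact: (covers_chain covers_cap_13 ok).
Qed.

(** * Upper bounds *)

Lemma set_packs_ge28 (A : {set V}) : 0 \notin A -> (28 <= #|A|)%N -> set_packs 9 A.
Proof.
move=> A0 cA; have ok : solutions_ok 9 (fun r => [pred x | x \notin r]) reps_3 solutions_3.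
  by vm_compute.
exact: (set_packs_coversC covers_3 ok A0 cA isT).
Qed.

Lemma set_packs_ge23 (A : {set V}) : 0 \notin A -> (23 <= #|A|)%N -> set_packs 7 A.
Proof.
move=> A0 cA; have ok : solutions_ok 7 (fun r => [pred x | x \notin r]) reps_8 solutions_8.
  by vm_compute.
exact: (set_packs_coversC covers_8 ok A0 cA isT).
Qed.

Lemma set_packs_ge21 (A : {set V}) : 0 \notin A -> (21 <= #|A|)%N -> set_packs 6 A.
Proof.
move=> A0 cA; have ok : solutions_ok 6 (fun r => [pred x | x \notin r]) reps_10 solutions_10.
  by vm_compute.
exact: (set_packs_coversC covers_10 ok A0 cA isT).
Qed.

Lemma set_packs_ge13 (A : {set V}) : 0 \notin A -> (13 <= #|A|)%N -> set_packs 3 A.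
Proof.
move=> A0 cA; case: (boolP (line_free A)) => [fA|nfA].
  have ok : solutions_ok 3 (fun r => mem r) cap_reps_13 cap_solutions_13 by vm_compute.
  exact: (set_packs_covers covers_cap_13 ok A0 cA fA).
by apply: (@set_packs_line 2 10) => // B _; apply: set_packs_ge10.
Qed.

Lemma set_packs_ge16 (A : {set V}) : 0 \notin A -> (16 <= #|A|)%N -> set_packs 4 A.
Proof.
move=> A0 cA; case: (boolP (line_free A)) => [fA|nfA].
  have ok : solutions_ok 4 (fun r => mem r) cap_reps_16 cap_solutions_16 by vm_compute.
  exact: (set_packs_covers covers_cap_16 ok A0 cA fA).
by apply: (@set_packs_line 3 13) => // B; apply: set_packs_ge13.
Qed.

Lemma set_packs_ge19 (A : {set V}) : 0 \notin A -> (19 <= #|A|)%N -> set_packs 5 A.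
Proof.
move=> A0 cA; apply: (@set_packs_line 4 16) => //; first by move=> B; apply: set_packs_ge16.
by rewrite line_of_ge17 // (leq_trans _ cA).
Qed.

Lemma set_packs_ge26 (A : {set V}) : 0 \notin A -> (26 <= #|A|)%N -> set_packs 8 A.
Proof.
move=> A0 cA; apply: (@set_packs_line 7 23) => //; first by move=> B; apply: set_packs_ge23.
by rewrite line_of_ge17 // (leq_trans _ cA).
Qed.

Lemma set_packs_ge31 (A : {set V}) : 0 \notin A -> (31 <= #|A|)%N -> set_packs 10 A.
Proof.
move=> A0 cA; apply: (@set_packs_line 9 28) => //; first by move=> B; apply: set_packs_ge28.
by rewrite line_of_ge17 // (leq_trans _ cA).
Qed.

(** The entry 0 starts the induction on [k]; the default value of [nth] supplies the linear range
    from [k = 10] on. *)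
Definition davenport (k : nat) : nat :=
  nth (11 + k * 2)%N [:: 0; 6; 10; 13; 16; 19; 21; 23; 26; 28]%N k.

Lemma davenport_ge10 k : (10 <= k)%N -> davenport k = (11 + k * 2)%N.
Proof. by move=> k10; rewrite /davenport nth_default. Qed.

Lemma davenportS k : (davenport k + 2 <= davenport k.+1)%N.
Proof.
case: (leqP 10 k) => [k10|]; last by do 10 (destruct k as [|k] => //).
by rewrite !davenport_ge10 ?(leqW k10) // mulSn addnCA addnC.
Qed.

Lemma set_packs_davenport k (A : {set V}) :
  0 \notin A -> (davenport k <= #|A|)%N -> set_packs k A.
Proof.
move=> A0 cA; have : (#|A| <= 31)%N.
  rewrite -[31%N](_ : #|[set~ (0 : V)]| = _); last by rewrite cardsC1 card_V.
  by apply: subset_leq_card; apply/subsetP => x xA; rewrite !inE; apply: contraNneq A0 => <-.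
(* Beyond [k = 10] the bound is at least 33, more than the 31 points available. *)
case: (ltnP 10 k) => [k10|].
  move=> /(leq_trans cA); rewrite davenport_ge10 ?(ltnW k10) // leqNgt.
  by rewrite -[32%N]/(10 + 11 * 2)%N leq_add // leq_mul2r k10 orbT.
case: k cA => [|[|[|[|[|[|[|[|[|[|[|k]]]]]]]]]]] // cA _ _.
- exact: set_packs_ge6.
- exact: set_packs_ge10.
- exact: set_packs_ge13.
- exact: set_packs_ge16.
- exact: set_packs_ge19.
- exact: set_packs_ge21.
- exact: set_packs_ge23.
- exact: set_packs_ge26.
- exact: set_packs_ge28.
- exact: set_packs_ge31.
Qed.

(** * Reduction of sequences to sets of points *)

Lemma perm_repeat (T : eqType) (s : seq T) :
  ~~ uniq s -> exists x r, perm_eq s [:: x, x & r].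
Proof.
elim: s => //= y s IHs; rewrite negb_and negbK => /orP[ys|/IHs[x [r p]]].
  by exists y, (rem y s); rewrite perm_cons perm_to_rem.
exists x, (y :: r); rewrite -(perm_cons y) in p; apply: perm_trans p _.
by rewrite -[[:: y, x, x & r]]/([:: y] ++ [:: x; x] ++ r) perm_catCA.
Qed.

(** A zero term or a pair of equal terms is split off as a block. This shortens the sequence by at
    most two, which [davenportS] allows for; otherwise the sequence is a set of points. *)
Lemma packs_davenport k (s : seq V) : (davenport k <= size s)%N -> packs k s.
Proof.
elim: k s => [|k IHk] s szs; first exact: packs0.
case: (boolP (0 \in s)) => [s0|s0].
  apply: (packs_perm (perm_to_rem s0)); apply: (@packs_block _ _ [:: 0]).
    by rewrite /zs_block big_seq1 eqxx.
  apply: IHk; rewrite size_rem // -ltnS prednK; last by case: s s0 {szs}.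
  by apply: leq_trans szs; apply: leq_trans (davenportS k); rewrite addn2 ltnS leqnSn.
case: (boolP (uniq s)) => [us|/perm_repeat[x [r p]]].
  apply: (@packs_perm _ _ _ (enum [set x in s])).
    by apply: uniq_perm; rewrite ?enum_uniq // => x; rewrite mem_enum inE.
  apply: packs_of_set_packs; apply: set_packs_davenport; first by rewrite inE.
  by rewrite cardsE (card_uniqP us).
apply: (packs_perm p); apply: (@packs_block _ _ [:: x; x]).
  by rewrite /zs_block big_cons big_seq1 addxx eqxx.
apply: IHk; rewrite -(leq_add2r 2) (leq_trans (davenportS k)) // (leq_trans szs) //.
by rewrite (perm_size p) /= addn2.
Qed.

(** * Lower bounds *)

(** A block of one term is 0 itself, and in characteristic 2 two terms with sum 0 are equal. *)
Lemma size_zs_block (b : seq V) : uniq b -> 0 \notin b -> zs_block b -> (3 <= size b)%N.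
Proof.
rewrite /zs_block; case: b => [|x [|y [|z b]]] //=.
  by rewrite big_seq1 inE eq_sym => _ /negPf ->.
by rewrite big_cons big_seq1 andbT inE addr_eq0 oppv => /negPf ->.
Qed.

(** The light vectors are those off a hyperplane; in terms of codes, the odd ones. *)
Definition low_weight (v : V) : nat := if v 0 0 == 0 then 2 else 1.

(* The number of terms with non-zero first coordinate is even, so a block of
   three terms has at most two of weight 1. *)
Lemma low_weight_block (b : seq V) :
  uniq b -> 0 \notin b -> zs_block b -> (4 <= \sum_(x <- b) low_weight x)%N.
Proof.
move=> ub b0 bP; have := size_zs_block ub b0 bP.
pose c := count (fun x : V => x 0 0 != 0) b.
have WE : (\sum_(x <- b) low_weight x + c = 2 * size b)%N.
  rewrite /c; elim: (b) => [|x l IHl]; first by rewrite big_nil.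
  by rewrite big_cons /= mulnS -IHl addnACA /low_weight; case: eqP.
(* Modulo 2, [c] is the sum of the first coordinates of the terms, which vanishes. *)
have : ~~ odd c.
  rewrite -dvdn2 (dvdn_pcharf (pchar_Fp (isT : prime 2))).
  have /andP[_ /eqP/rowP/(_ 0)] := bP; rewrite summxE mxE => <-; apply/eqP.
  rewrite /c; elim: (b) => [|x l IHl]; first by rewrite big_nil.
  rewrite big_cons /= natrD IHl; congr (_ + _).
  by case: (x 0 0) => -[|[|]] //= i; apply: val_inj.
have : (c <= size b)%N by apply: count_size.
(* The claim becomes [4 + c <= 2 * size b]. It follows from [c <= size b] for four or more terms,
   and from [c <= 2], by parity, for three. *)
rewrite -(leq_add2r c 4) {}WE; case: (size b) => [|[|[|[|n]]]] //.
  by case: (c) => [|[|[|[|]]]].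
by move=> le _ _; rewrite mul2n -addnn leq_add.
Qed.

(** A packing that leaves out nothing, or a single term, is impossible if the total sum is a point
    not occurring in [l]. *)
Definition xor_outside (l : seq N) :=
  (foldr N.lxor 0%num l \in points) && (foldr N.lxor 0%num l \notin l).

Lemma not_packs_vec (w : V -> nat) c k l :
    (forall b, uniq b -> 0 \notin b -> zs_block b -> (c <= \sum_(x <- b) w x)%N) ->
    (forall v, (0 < w v)%N) ->
    well_formed l -> xor_outside l -> (\sum_(x <- l) w (vec x) <= c * k + 1)%N ->
  ~ packs k [seq vec x | x <- l].
Proof.
move=> cP w0 /andP[ul /allP lP] /andP[xP xl] Wl.
have l0 : 0 \notin [seq vec x | x <- l].
  by apply/mapP => -[x /lP/vec_point_neq0 /eqP x0 /esym].
apply: (@not_packs _ w c) => //.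
- move=> b r bP p; apply: cP => //.
    by have := uniq_vec ul lP; rewrite (perm_uniq p) cat_uniq => /andP[].
  by apply: contra l0; rewrite (perm_mem p) mem_cat => ->.
- by rewrite big_map.
- by rewrite big_map -vec_foldr vec_point_neq0.
- move=> _ /mapP[x xl' ->] _; rewrite big_map -vec_foldr; apply/eqP.
  by move/(vec_inj (lP _ xl') xP) => e; rewrite -e xl' in xl.
Qed.

Lemma not_packs_low k l : well_formed l -> xor_outside l ->
    (sumn [seq if N.testbit x 0 then 1 else 2 | x <- l] <= 4 * k + 1)%N ->
  ~ packs k [seq vec x | x <- l].
Proof.
move=> wl xl Wl; apply: (@not_packs_vec low_weight 4) => //.
- exact: low_weight_block.
- by move=> v; rewrite /low_weight; case: eqP.
move: Wl; rewrite sumnE big_map; congr (_ <= _)%N; apply: eq_bigr => x _.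
by rewrite /low_weight mxE /=; case: N.testbit.
Qed.

Lemma not_packs_size k l : well_formed l -> xor_outside l -> (size l <= 3 * k + 1)%N ->
  ~ packs k [seq vec x | x <- l].
Proof.
move=> wl xl Wl; apply: (@not_packs_vec (fun=> 1%N) 3) => //.
- by move=> b ub b0 bP; rewrite sum1_size; apply: size_zs_block.
- by rewrite sum1_size.
Qed.

Definition odd_points : seq N := [seq x <- points | N.odd x].

(* Up to [k = 6] the extremal sequences lie, up to a few terms, in the affine
   hyperplane of odd numbers; afterwards they are complements of small sets. *)
Definition extremal (k : nat) : seq N :=
  nth [::]
    [:: [::];
        [:: 1; 3; 5; 9; 17];
        [seq x <- odd_points | x \notin [:: 1; 3; 5; 9; 17; 31; 7]];
        [seq x <- odd_points | x \notin [:: 1; 3; 5; 9]];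
        [seq x <- odd_points | x != 31];
        odd_points ++ [:: 2; 4];
        odd_points ++ [:: 2; 4; 8; 16];
        [seq x <- points | x \notin [:: 1; 2; 4; 7; 8; 16; 11; 19; 31]];
        [seq x <- points | x \notin [:: 1; 2; 4; 8; 15; 31]];
        [seq x <- points | x \notin [:: 1; 2; 3; 31]]]%num k.

(** Up to [k = 6] the total weight is at most [4 * k + 1], odd codes counting 1 and even ones 2. For
    [k] = 7, 8, 9 there are 22, 25 and 27 points, at most [3 * k + 1]. *)
Lemma not_packs_extremal k : (0 < k < 10)%N -> ~ packs k [seq vec x | x <- extremal k].
Proof.
case: (ltnP k 7) => [k7 k0|k7 k10].
  by apply: not_packs_low; do 7 (destruct k as [|k] => //).
apply: not_packs_size.
all: move: k7 k10; do 10 (destruct k as [|k]; first by []); by [].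
Qed.

Lemma size_extremal k : (0 < k < 10)%N -> (size (extremal k)).+1 = davenport k.
Proof. by do 10 (destruct k as [|k] => //). Qed.

(** * The linear range *)

Definition eventual_extremal (k : nat) : seq V :=
  [seq vec x | x <- [seq x <- points | x != 31%num]] ++ nseq ((k - 10) * 2) (vec 31).

(** Weight 3 is given to [vec 31] and 2 to every other point. A block consists of two copies of
    [vec 31] or has at least three terms, so it weighs at least 6, while the whole sequence weighs
    [6 * k]. As no term has weight 1, [k] blocks would leave out nothing, yet the sum is
    [vec 31]. *)
Lemma not_packs_eventual k : (10 <= k)%N -> ~ packs k (eventual_extremal k).
Proof.
move=> k10; set s := eventual_extremal k.
pose w (v : V) := if v == vec 31 then 3%N else 2%N.
have w2 v : (2 <= w v)%N by rewrite /w; case: eqP.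
have p31 : 31%num \in points by [].
set l := [seq x <- points | x != 31%num].
have lP : {subset l <= points} by move=> x; rewrite mem_filter => /andP[].
have ul : uniq l by [].
have sP v : v \in s -> exists2 x, x \in points & v = vec x.
  rewrite mem_cat => /orP[/mapP[x /lP xP ->]|]; first by exists x.
  by rewrite mem_nseq => /andP[_ /eqP ->]; exists 31%num.
have sum_s : \sum_(x <- s) x = vec 31.
  rewrite /s /eventual_extremal big_cat big_map -vec_foldr big_nseq.
  (* The number of copies is even, so they cancel; the other 30 points sum to [vec 31] because all
     31 points sum to 0. *)
  have -> : iter ((k - 10) * 2) (+%R (vec 31)) 0 = 0.
    by elim: (k - 10)%N => //= n ->; rewrite addr0 addxx.
  exact: addr0.
apply: (@not_packs _ w 6).
- move=> b r bP p.
  have bs : {subset b <= s} by move=> x xb; rewrite (perm_mem p) mem_cat xb.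
  have b0 : 0 \notin b.
    by apply/negP => /bs/sP[x /vec_point_neq0/eqP x0 /esym].
  move: bP b0; rewrite /zs_block; case: b p {bs} => [|x [|y [|z b]]] //= p.
  + by rewrite big_seq1 inE eq_sym => /eqP ->; rewrite eqxx.
  + rewrite !big_cons !big_nil addr0 addr_eq0 oppv => /eqP xy _.
    rewrite -{}xy addn0 /w in p *; case: eqP => // /eqP x31.
    (* Two equal terms different from [vec 31] cannot both occur: such a point appears only once in
       the sequence. *)
    have := permP p (pred1 x); rewrite count_cat count_uniq_mem; last exact: uniq_vec.
    rewrite count_nseq /= eq_sym (negPf x31) mul0n addn0 eqxx !add1n.
    by case: (x \in _).
  + move=> _ _; rewrite !big_cons.
    by rewrite (leq_add (w2 x) (leq_add (w2 y) (leq_add (w2 z) _))).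
- by move=> x _; rewrite (leq_trans _ (w2 x)).
- rewrite /s /eventual_extremal big_cat big_map big_seq_cond (eq_bigr (fun=> 2%N)); last first.
    move=> x /andP[xl _]; rewrite /w; case: eqP => // /(vec_inj (lP _ xl) p31) e.
    by move: xl; rewrite e mem_filter eqxx.
  rewrite -big_seq_cond big_const_seq big_nseq /w eqxx !iter_addn_0 addn1 leqW //.
  have -> : count predT l = 30%N by [].
  (* The 30 single points weigh 60 and the copies [6 * (k - 10)], together [6 * k]. *)
  by rewrite -[k in leqRHS](subnKC k10) mulnDr leq_add // mulnA mulnAC.
- by rewrite sum_s vec_point_neq0.
- by move=> x _; rewrite /w; case: eqP.
Qed.

Lemma is_Dk_davenport k : (0 < k)%N -> is_Dk C2_5 k (davenport k).
Proof.
move=> k0; case: (ltnP k 10) => k10.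
  have kP : (0 < k < 10)%N by rewrite k0.
  rewrite -size_extremal //; apply: is_Dk_intro => [s|].
    by rewrite size_extremal //; apply: packs_davenport.
  exists [seq vec x | x <- extremal k]; first by rewrite size_map.
  exact: not_packs_extremal.
have dE : davenport k = (10 + k * 2).+1 by rewrite davenport_ge10.
rewrite dE; apply: is_Dk_intro => [s|]; first by rewrite -dE; apply: packs_davenport.
exists (eventual_extremal k); last exact: not_packs_eventual.
(* The length is 30 + 2(k - 10) = 10 + 2k, one less than the claimed constant. *)
rewrite size_cat size_nseq size_map mulnBl.
have -> : size [seq x <- points | x != 31%num] = (10 + 10 * 2)%N by [].
by rewrite -addnA subnKC // leq_mul2r k10.
Qed.

(* exp(C_2^5) = 2 *)
Theorem theorem7p10 :
  is_D0 C2_5 2 11 /\ is_kD C2_5 2 11 10 /\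
  is_Dk C2_5 1 6 /\ is_Dk C2_5 2 10 /\ is_Dk C2_5 3 13 /\
  is_Dk C2_5 4 16 /\ is_Dk C2_5 5 19 /\ is_Dk C2_5 6 21 /\
  is_Dk C2_5 7 23 /\ is_Dk C2_5 8 26 /\ is_Dk C2_5 9 28.
Proof.
have lin : lin_from C2_5 2 11 10.
  move=> k k10; rewrite -davenport_ge10 //; apply: is_Dk_davenport.
  exact: leq_trans k10.
split; first by exists 10.
split; last by do ![split; first exact: is_Dk_davenport]; apply: is_Dk_davenport.
split=> //; split=> // k1 _ lin1; rewrite leqNgt; apply/negP => k9.
(* A linear range starting before 10 would include [k = 9] with value 11 + 18 = 29, but sequences of
   length 28 already suffice there. *)
have [_ /(_ 28)] := lin1 9 k9.
by have [up _] := @is_Dk_davenport 9 isT => /(_ up).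
Qed.
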